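(* Let $1\le s,q,r,p<\infty$ with $q<s$ and $r\le s$. If $p\le q$, then the pair $\left( \mathcal{W}^{A}_{(s,q,r;p)};w^{A}_{(s,q,r;p)}(\cdot)\right)$ is a Banach ideal of operators. If $q\le p$, then the pair $\left( \Pi^{A}_{(p;s,q,r)};\pi^{A}_{(p;s,q,r)}(\cdot)\right)$ is a Banach ideal of operators.
   Context: Banach spaces are over $\mathbb{K}=\mathbb{R}$ or $\mathbb{C}$; $B_X$ is the closed unit ball of $X$, $X^*$ its topological dual, $\mathcal{L}(U;X)$ the space of continuous linear operators. ''Banach ideal of operators'' is the standard notion of a Banach operator ideal in the sense of Pietsch, with components ranging over all pairs $(U,X)$ of Banach spaces. $\ell_p(X)$ is the space of absolutely $p$-summable $X$-valued sequences with its usual norm $\|\cdot\|_p$, and $\ell_p^w(X)$ the space of weakly $p$-summable ones with norm $\|(x_j)_j\|_{w,p}=\sup_{x^*\in B_{X^*}}\|(x^*(x_j))_{j}\|_p$. The space $\ell^{A}_{(s,q,r)}(X)$ consists of all sequences $(x_j)_{j=1}^\infty$ in $X$ such that $\sum_{j=1}^\infty\left(\sum_{k=1}^\infty|x_k^*(x_j)|^s\right)^{q/s}<\infty$ for every $(x_k^* )_{k=1}^\infty\in\ell_r(X^* )$, with the norm $$\|(x_j)_{j=1}^\infty\|_{A(s,q,r)}=\sup_{(x_k^* )_k\in B_{\ell_r(X^* )}}\left(\sum_{j=1}^\infty\left(\sum_{k=1}^\infty|x_k^*(x_j)|^s\right)^{q/s}\right)^{1/q}.$$ For $1\le p\le q<s$,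 $1\le r\le s$: $\mathcal{W}^{A}_{(s,q,r;p)}(U;X)$ is the class of weakly anisotropic $(s,q,r;p)$-summing operators, i.e. those $T\in\mathcal{L}(U;X)$ such that $(T(u_j))_{j=1}^\infty\in\ell^{A}_{(s,q,r)}(X)$ whenever $(u_j)_{j=1}^\infty\in\ell_p^w(U)$; $w^{A}_{(s,q,r;p)}(T)$ is the infimum of all $D>0$ such that $\|(T(u_j))_{j=1}^\infty\|_{A(s,q,r)}\le D\|(u_j)_{j=1}^\infty\|_{w,p}$ for all $(u_j)_{j=1}^\infty\in\ell_p^w(U)$. For $1\le q<s$, $q\le p$, $1\le r\le s$: $\Pi^{A}_{(p;s,q,r)}(U;X)$ is the class of anisotropic $(p;s,q,r)$-summing operators, i.e. those $T\in\mathcal{L}(U;X)$ such that $(T(u_j))_{j=1}^\infty\in\ell_p(X)$ whenever $(u_j)_{j=1}^\infty\in\ell^{A}_{(s,q,r)}(U)$; $\pi^{A}_{(p;s,q,r)}(T)$ is the infimum of all $D>0$ such that $\|(T(u_j))_{j=1}^\infty\|_p\le D\|(u_j)_{j=1}^\infty\|_{A(s,q,r)}$ for all $(u_j)_{j=1}^\infty\in\ell^{A}_{(s,q,r)}(U)$. *)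

(* Defs.v *)
From HB Require Import structures.
From mathcomp Require Import all_boot all_order all_algebra.
From mathcomp Require Import complex.
From mathcomp Require Import all_classical all_reals all_analysis.
Set Implicit Arguments.
Unset Strict Implicit.
Unset Printing Implicit Defensive.
Import Order.TTheory GRing.Theory Num.Theory.
Import numFieldNormedType.Exports.
Local Open Scope classical_set_scope.
Local Open Scope ring_scope.

Variant scalar_kind := RealScalars | ComplexScalars.

Definition scalars (R : realType) (K : scalar_kind) : numFieldType :=
  match K with
  | RealScalars => R
  | ComplexScalars => R[i]
  end.

Definition scalar_re (R : realType) (K : scalar_kind) : scalars R K -> R :=
  match K return scalars R K -> R with
  | RealScalars => fun x => x
  | ComplexScalars => fun z => complex.Re z
  end.

(* Norms over R[i] are R[i]-valued; they are real, so taking the real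
   part loses nothing. *)
Definition rnorm (R : realType) (K : scalar_kind)
  (X : normedModType (scalars R K)) (x : X) : R := scalar_re `|x|.

Lemma norm_Im_le (R : rcfType) (z : R[i]) : (`|complex.Im z|%:C <= `|z|)%C.
Proof.
by rewrite normc_def lecR -sqrtr_sqr ler_sqrt ?addr_ge0 ?sqr_ge0// lerDr sqr_ge0.
Qed.

Lemma norm_le_ReIm (R : rcfType) (z : R[i]) :
  (`|z| <= (`|complex.Re z| + `|complex.Im z|)%:C)%C.
Proof.
rewrite normc_def lecR; set u := `|_|; set v := `|_|.
have uv0 : 0 <= u + v by exact: addr_ge0 (normr_ge0 _) (normr_ge0 _).
rewrite -(ger0_norm uv0) -sqrtr_sqr ler_sqrt ?sqr_ge0//.
by rewrite sqrrD /u /v !real_normK ?num_real// lerD2r lerDl mulrn_wge0// mulr_ge0 ?normr_ge0.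
Qed.

Lemma complex_cauchy_cvg (R : realType) (F : set_system R[i]^o) :
  ProperFilter F -> cauchy F -> cvg F.
Proof.
move=> FF /cauchy_ballP cF.
have cauchy_part (f : R[i]^o -> R) :
    (forall x y, (`|f x - f y|%:C <= `|x - y|)%C) -> cvg (f @ F).
  move=> fle; apply: R_complete; apply/cauchy_ballP => e e0.
  have eC0 : 0 < (e%:C)%C :> R[i] by rewrite ltcR.
  have [[A B] /= [FA FB] AB] := cF _ eC0.
  exists (f @` A, f @` B) => /=.
    by split; [apply: filterS FA|apply: filterS FB] => x ?; exists x.
  move=> [_ _] /= [[a Aa <-] [b Bb <-]].
  by rewrite /ball/= -ltcR (le_lt_trans (fle a b))//; exact: (AB (a, b)).
have /cvg_ex[a /cvgrPdist_le Fa] : cvg ((fun z : R[i]^o => complex.Re z) @ F).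
  by apply: cauchy_part => -[x y] [x' y']; exact: normc_ge_Re (_ +i* _)%C.
have /cvg_ex[b /cvgrPdist_le Fb] : cvg ((fun z : R[i]^o => complex.Im z) @ F).
  by apply: cauchy_part => -[x y] [x' y']; exact: norm_Im_le (_ +i* _)%C.
apply/cvg_ex; exists (a +i* b)%C; apply/cvgrPdist_le => -[e e'].
rewrite ltcE /= => /andP[/eqP -> e0].
have e20 : 0 < e / 2 by rewrite divr_gt0.
have ReB z : complex.Re ((a +i* b)%C - z) = a - complex.Re z by case: z.
have ImB z : complex.Im ((a +i* b)%C - z) = b - complex.Im z by case: z.
near=> z; apply: (le_trans (norm_le_ReIm _)).
rewrite lecR [leRHS]splitr ReB ImB lerD//.
- by near: z; exact: Fa.
- by near: z; exact: Fb.
Unshelve. all: by end_near. Qed.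

Lemma scalars_cauchy_cvg (R : realType) (K : scalar_kind)
  (F : set_system (scalars R K)^o) : ProperFilter F -> cauchy F -> cvg F.
Proof. by case: K F; [exact: R_complete|exact: complex_cauchy_cvg]. Qed.

Notation banach R K := (completeNormedModType (scalars R K)).

Definition scalar_space (R : realType) (K : scalar_kind) : banach R K :=
  HB.pack (scalars R K)^o
    (Uniform_isComplete.Build (scalars R K)^o (@scalars_cauchy_cvg R K)).

Local Open Scope ereal_scope.

Section operators.
Variables (R : realType) (K : scalar_kind).

Definition cont_linear (U X : banach R K) : set (U -> X) :=
  [set T | linear T /\ continuous T].

Definition dual (X : banach R K) : set (X -> scalar_space R K) :=
  @cont_linear X (scalar_space R K).

Definition opnorm (U X : banach R K) (T : U -> X) : \bar R :=
  ereal_sup [set (rnorm (T u))%:E | u in [set u : U | (rnorm u <= 1)%R]].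

Definition finite_rank (U X : banach R K) (T : U -> X) : Prop :=
  exists (n : nat) (x : 'I_n -> X), forall u : U,
    exists c : 'I_n -> scalars R K, T u = (\sum_(i < n) c i *: x i)%R.

End operators.

Section operator_ideals.
Variables (R : realType) (K : scalar_kind).

Record operator_ideal (I : forall U X : banach R K, set (U -> X)) : Prop := {
  ideal_cont_linear : forall U X : banach R K, I U X `<=` @cont_linear R K U X;
  ideal_finite_rank : forall (U X : banach R K) (T : U -> X),
    cont_linear T -> finite_rank T -> I U X T;
  ideal_add : forall (U X : banach R K) (S T : U -> X),
    I U X S -> I U X T -> I U X (S + T)%R;
  ideal_scale : forall (U X : banach R K) (a : scalars R K) (T : U -> X),
    I U X T -> I U X (a *: T)%R;
  ideal_comp : forall (V U X Y : banach R K)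
      (A : V -> U) (T : U -> X) (B : X -> Y),
    cont_linear A -> I U X T -> cont_linear B -> I V Y (B \o T \o A)
}.

(* The norm takes values in \bar R so that the infimum defining it is not given
   a junk value; its finiteness on the ideal is part of the definition. *)
Record banach_ideal (I : forall U X : banach R K, set (U -> X))
    (N : forall U X : banach R K, (U -> X) -> \bar R) : Prop := {
  banach_ideal_ideal : operator_ideal I;
  ideal_norm_fin : forall (U X : banach R K) (T : U -> X),
    I U X T -> 0 <= N U X T < +oo;
  ideal_norm_eq0 : forall (U X : banach R K) (T : U -> X),
    I U X T -> N U X T = 0 -> T = 0%R;
  ideal_normZ : forall (U X : banach R K) (a : scalars R K) (T : U -> X),
    I U X T ->
    N U X (a *: T)%R = (rnorm (a : scalar_space R K))%:E * N U X T;
  ideal_normD : forall (U X : banach R K) (S T : U -> X),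
    I U X S -> I U X T -> N U X (S + T)%R <= N U X S + N U X T;
  ideal_norm_id : N (scalar_space R K) (scalar_space R K) id = 1;
  ideal_norm_comp : forall (V U X Y : banach R K)
      (A : V -> U) (T : U -> X) (B : X -> Y),
    cont_linear A -> I U X T -> cont_linear B ->
    N V Y (B \o T \o A) <= opnorm B * N U X T * opnorm A;
  ideal_complete : forall (U X : banach R K) (T : (U -> X)^nat),
    (forall n, I U X (T n)) ->
    (forall e : R, (0 < e)%R ->
      \forall m & n \near \oo, N U X (T m - T n)%R < e%:E) ->
    exists2 S, I U X S & N U X (T n - S)%R @[n --> \oo] --> 0
}.

End operator_ideals.

Section sequence_spaces.
Variables (R : realType) (K : scalar_kind).

Definition power_sum (p : R) (a : (\bar R)^nat) : \bar R :=
  \sum_(0 <= j <oo) (a j `^ p).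

Definition ell (p : R) (X : banach R K) : set X^nat :=
  [set x | power_sum p (fun j => (rnorm (x j))%:E) < +oo].

Definition ell_norm (p : R) (X : banach R K) (x : X^nat) : \bar R :=
  power_sum p (fun j => (rnorm (x j))%:E) `^ p^-1.

Definition ell_weak (p : R) (X : banach R K) : set X^nat :=
  [set x | forall f, dual f -> ell p (fun j => f (x j))].

Definition ell_weak_norm (p : R) (X : banach R K) (x : X^nat) : \bar R :=
  ereal_sup [set ell_norm p (fun j => f (x j)) |
    f in [set f | dual f /\ opnorm f <= 1]].

Definition ell_dual (r : R) (X : banach R K) :
    set (X -> scalar_space R K)^nat :=
  [set f | (forall k, dual (f k)) /\ power_sum r (fun k => opnorm (f k)) < +oo].

Definition ell_dual_norm (r : R) (X : banach R K)
    (f : (X -> scalar_space R K)^nat) : \bar R :=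
  power_sum r (fun k => opnorm (f k)) `^ r^-1.

Definition aniso_sum (s q : R) (X : banach R K)
    (f : (X -> scalar_space R K)^nat) (x : X^nat) : \bar R :=
  \sum_(0 <= j <oo)
    (power_sum s (fun k => (rnorm (f k (x j)))%:E) `^ (q / s)).

Definition ell_aniso (s q r : R) (X : banach R K) : set X^nat :=
  [set x | forall f, ell_dual r f -> aniso_sum s q f x < +oo].

Definition ell_aniso_norm (s q r : R) (X : banach R K) (x : X^nat) : \bar R :=
  ereal_sup [set aniso_sum s q f x `^ q^-1 |
    f in [set f | ell_dual r f /\ ell_dual_norm r f <= 1]].

End sequence_spaces.

Section summing_operators.
Variables (R : realType) (K : scalar_kind).

Definition weakly_aniso_summing (s q r p : R) (U X : banach R K) :
    set (U -> X) :=
  [set T | cont_linear T /\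
    forall u, ell_weak p u -> ell_aniso s q r (T \o u)].

Definition weakly_aniso_norm (s q r p : R) (U X : banach R K) (T : U -> X) :
    \bar R :=
  ereal_inf [set D%:E | D in [set D : R | (0 < D)%R /\
    forall u, ell_weak p u ->
      ell_aniso_norm s q r (T \o u) <= D%:E * ell_weak_norm p u]].

Definition aniso_summing (p s q r : R) (U X : banach R K) : set (U -> X) :=
  [set T | cont_linear T /\ forall u, ell_aniso s q r u -> ell p (T \o u)].

Definition aniso_norm (p s q r : R) (U X : banach R K) (T : U -> X) : \bar R :=
  ereal_inf [set D%:E | D in [set D : R | (0 < D)%R /\
    forall u, ell_aniso s q r u ->
      ell_norm p (T \o u) <= D%:E * ell_aniso_norm s q r u]].

End summing_operators.

(* Main.v *)
(* Both ideals have the form "T maps E(U) into F(X)" for sequence classes E and F,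
   where F(K) contains E(K) contractively for the scalar field K.

   Boundedness: if the inequality with D = 4^n failed for every n, rescaled witnesses
   u^n with E-norm at most 2^-n and F-norm of T u^n at least 2^n could be interleaved
   into one sequence of E(U) whose image is not in F(X).  Interleaving functionals with
   weights 2^-n shows in the same way that the anisotropic norm is finite on its space;
   for weakly summable sequences finiteness is the uniform boundedness principle on the
   dual, proved by a gliding hump.

   Finite rank operators are sums of operators g (.) y, by Hahn-Banach, and for those
   membership reduces to the inclusion E(K) in F(K).  A Cauchy sequence of operators
   converges pointwise, and lower semicontinuity of the F-norm under pointwise
   convergence transfers the estimates to the limit. *)
Require Import Defs.
From HB Require Import structures.
From mathcomp Require Import all_boot all_order all_algebra.
From mathcomp Require Import complex.
From mathcomp Require Import all_classical all_reals all_analysis.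
From mathcomp Require Import ring lra.
Set Implicit Arguments.
Unset Strict Implicit.
Unset Printing Implicit Defensive.
Import Order.TTheory GRing.Theory Num.Theory.
Import numFieldNormedType.Exports.
Local Open Scope classical_set_scope.
Local Open Scope ring_scope.

(** * Norms of extended real sequences *)

Section lp_norm.
Variable R : realType.
Local Open Scope ereal_scope.
Implicit Types (p q : R) (a b : (\bar R)^nat).

(** Norms here are extended real functions of all sequences: a space is the set where its norm is
    finite, and the axioms of [sequence_class] are inequalities free of membership conditions on the
    sequences. The definitions of the spaces test each functional, or each sequence of functionals,
    separately; passing from separate finiteness to a finite supremum is the analytic core. For the
    anisotropic norm the tests are sequences of functionals, and countably many of these merge into
    another one without interacting. The weak norm tests with single functionals, so the witnesses
    have to be added up and may cancel, which is why signs must be chosen. The growth 4^n is 2^n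
    times 2^n: one factor pays for making the witnesses summable, the other keeps their images
    unbounded. Boundedness obtained in this way uses no completeness of the sequence spaces, unlike
    a closed graph argument. *)

Definition lp p a : \bar R := power_sum p a `^ p^-1.

Lemma le_poweR p (x y : \bar R) : (0 <= p)%R -> 0 <= x -> x <= y ->
  x `^ p <= y `^ p.
Proof.
move=> p0 x0 xy; apply: gt0_ler_poweR => //; rewrite in_itv/= leey andbT//.
exact: le_trans xy.
Qed.

Lemma poweRK p (x : \bar R) : p != 0%R -> 0 <= x -> (x `^ p) `^ p^-1 = x.
Proof. by move=> p0 x0; rewrite -poweRrM mulfV// poweRe1. Qed.

Lemma poweRVK p (x : \bar R) : p != 0%R -> 0 <= x -> (x `^ p^-1) `^ p = x.
Proof. by move=> p0 x0; rewrite -poweRrM mulVf// poweRe1. Qed.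

Lemma power_sum_ge0 p a : 0 <= power_sum p a.
Proof. by apply: nneseries_ge0 => n _ _; exact: poweR_ge0. Qed.
Hint Resolve power_sum_ge0 : core.

Lemma lp_ge0 p a : 0 <= lp p a.
Proof. exact: poweR_ge0. Qed.
Hint Resolve lp_ge0 : core.

Lemma lp_power p a : p != 0%R -> lp p a `^ p = power_sum p a.
Proof. by move=> p0; rewrite poweRVK. Qed.

Lemma lp_lty p a : p != 0%R -> (lp p a < +oo) <-> (power_sum p a < +oo).
Proof.
move=> p0; split; last exact: poweR_lty.
by apply: lty_poweRy; rewrite invr_eq0.
Qed.

Lemma lp_leP p a c : (0 < p)%R -> 0 <= c ->
  (lp p a <= c) <-> (power_sum p a <= c `^ p).
Proof.
move=> p0 c0; split=> h.
  by rewrite -lp_power ?gt_eqF// le_poweR// ltW.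
by rewrite -(@poweRK p c) ?gt_eqF// le_poweR// invr_ge0 ltW.
Qed.

Lemma le_lp p a b : (0 < p)%R -> (forall j, 0 <= a j) ->
  (forall j, a j <= b j) -> lp p a <= lp p b.
Proof.
move=> p0 a0 ab; rewrite le_poweR ?invr_ge0 ?(ltW p0)//.
rewrite /power_sum; apply: lee_nneseries => j _; first by move=> _; exact: poweR_ge0.
by rewrite le_poweR// ltW.
Qed.

Lemma le_lp_term p a j : (0 < p)%R -> (forall j, 0 <= a j) -> a j <= lp p a.
Proof.
move=> p0 a0; rewrite -(@poweRK p (a j)) ?gt_eqF// le_poweR ?poweR_ge0//.
  by rewrite invr_ge0 ltW.
rewrite /power_sum (@nneseriesD1 _ _ j xpredT)//; last by move=> *; exact: poweR_ge0.
by rewrite leeDl// nneseries_ge0// => *; exact: poweR_ge0.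
Qed.

Lemma lp1 a : (forall j, 0 <= a j) -> lp 1 a = \sum_(0 <= j <oo) a j.
Proof.
move=> a0; rewrite /lp invr1 poweRe1// /power_sum.
by apply: eq_eseriesr => j _; rewrite poweRe1.
Qed.

Lemma lpZ p (c : R) a : (0 < p)%R -> (0 <= c)%R -> (forall j, 0 <= a j) ->
  lp p (fun j => c%:E * a j) = c%:E * lp p a.
Proof.
move=> p0 c0 a0; rewrite /lp /power_sum.
under eq_eseriesr do rewrite poweRM// ?lee_fin// poweR_EFin.
rewrite nneseriesZl; last by move=> *; exact: poweR_ge0.
rewrite poweRM ?lee_fin ?powR_ge0//; first by rewrite -poweR_EFin poweRK ?gt_eqF.
exact: power_sum_ge0.
Qed.

Lemma lp_eq0 p a : (0 < p)%R -> (forall j, a j = 0) -> lp p a = 0.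
Proof.
move=> p0 a0; rewrite /lp /power_sum eseries0 ?poweR0r ?invr_eq0 ?gt_eqF//.
by move=> i _ _; rewrite a0 poweR0r// gt_eqF.
Qed.

(** With [c] the [p]-norm, every term is at most [c], so [a j ^ q <= c ^ (q - p) * a j ^ p], and
    summation gives [c ^ q]. The values 0 and +oo of [c] are treated apart because powers of [c] are
    split. *)
Lemma lp_incl p q a : (0 < p)%R -> (p <= q)%R -> (forall j, 0 <= a j) ->
  lp q a <= lp p a.
Proof.
move=> p0 pq a0; have q0 := lt_le_trans p0 pq.
have [->|pfin] := eqVneq (lp p a) +oo; first by rewrite leey.
have [pa0|pa_neq0] := eqVneq (lp p a) 0.
  rewrite pa0 lp_eq0// => j; apply/eqP; rewrite eq_le a0 andbT -pa0.
  exact: le_lp_term.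
apply/lp_leP => //.
have [c cE] : exists c : R, lp p a = c%:E.
  by exists (fine (lp p a)); rewrite fineK// ge0_fin_numE// ltey.
have c0 : (0 < c)%R by rewrite -lte_fin -cE lt0e pa_neq0 lp_ge0.
have -> : lp p a `^ q = (c `^ (q - p))%:E * power_sum p a.
  rewrite -(lp_power a (negbT (gt_eqF p0))) cE !poweR_EFin -EFinM -powRD ?subrK//.
  by rewrite (gt_eqF c0) implybT.
rewrite -nneseriesZl; last by move=> *; exact: poweR_ge0.
rewrite /power_sum; apply: lee_nneseries => j _; first by move=> _; exact: poweR_ge0.
have [->|aj0] := eqVneq (a j) 0.
  by rewrite poweR0r ?gt_eqF// mule_ge0 ?lee_fin ?powR_ge0.
rewrite -{1}(subrK p q) poweRD; last first.
  by rewrite nneg_neq0_poweRD_def// ?subr_ge0// ltW.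
rewrite lee_wpmul2r ?poweR_ge0// -poweR_EFin -cE le_poweR ?subr_ge0//.
exact: le_lp_term.
Qed.

Lemma le_lp_series p a : (1 <= p)%R -> (forall j, 0 <= a j) ->
  lp p a <= \sum_(0 <= j <oo) a j.
Proof. by move=> p1 a0; rewrite -lp1// lp_incl. Qed.

(** An infinite norm on the right makes the bound trivial; finite norms force finite terms, and then
    this is Minkowski's inequality for the counting measure. *)
Lemma lpD p a b : (1 <= p)%R -> (forall j, 0 <= a j) -> (forall j, 0 <= b j) ->
  lp p (fun j => a j + b j) <= lp p a + lp p b.
Proof.
move=> p1 a0 b0; have p0 := lt_le_trans ltr01 p1.
have [->|ay] := eqVneq (lp p a) +oo.
  by rewrite addye ?leey// gt_eqF// (lt_le_trans _ (lp_ge0 p b)).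
have [->|By] := eqVneq (lp p b) +oo.
  by rewrite addey ?leey// gt_eqF// (lt_le_trans _ (lp_ge0 p a)).
have fine_seq c : (forall j, 0 <= c j) -> lp p c != +oo ->
    exists2 f : nat -> R, (forall j, (0 <= f j)%R) & c = EFin \o f.
  move=> c0 cy; exists (fine \o c) => [j|]; first exact: fine_ge0.
  apply/funext => j /=; rewrite fineK// ge0_fin_numE//.
  by rewrite (le_lt_trans (le_lp_term j p0 c0))// ltey.
have [f f0 aE] := fine_seq _ a0 ay; have [g g0 bE] := fine_seq _ b0 By.
have lpE h : (forall j, (0 <= h j)%R) ->
    lp p (EFin \o h) = Lnorm counting p%:E (EFin \o h).
  move=> h0; rewrite Lnorm_counting// /lp /power_sum; congr (_ `^ _).
  by apply: eq_eseriesr => j _ /=; rewrite ger0_norm.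
rewrite aE bE [leLHS](_ : _ = lp p (EFin \o (f \+ g)%R))//.
rewrite !lpE//; last by move=> j /=; exact: addr_ge0.
exact: minkowski_EFin.
Qed.

Definition trunc (V : nmodType) (n : nat) (x : nat -> V) : nat -> V :=
  fun j => if (j < n)%N then x j else 0%R.

Lemma lp_le_trunc p a c : (0 < p)%R -> 0 <= c -> (forall j, 0 <= a j) ->
  (forall n, lp p (fun j => if (j < n)%N then a j else 0) <= c) -> lp p a <= c.
Proof.
move=> p0 c0 a0 h; apply/lp_leP => //.
apply: lime_le; first by apply: is_cvg_nneseries => *; exact: poweR_ge0.
apply: nearW => n; have /lp_leP := h n; move=> /(_ p0 c0); apply: le_trans.
apply: (@le_trans _ _ (\sum_(0 <= j < n)
   ((fun j => if (j < n)%N then a j else 0) j `^ p))); last first.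
  by apply: nneseries_lim_ge => *; exact: poweR_ge0.
by rewrite !big_mkord; apply: lee_sum => i _ /=; rewrite ltn_ord.
Qed.

End lp_norm.
#[global] Hint Resolve power_sum_ge0 lp_ge0 : core.

Lemma half_series_lty (R : realType) :
  (\sum_(0 <= n <oo) (2 ^- n : R)%:E < +oo)%E.
Proof.
apply: (@le_lt_trans _ _ 2%:E); last exact: ltry.
apply: lime_le.
  by apply: is_cvg_nneseries => n _ _; rewrite lee_fin invr_ge0 exprn_ge0.
apply: nearW => n; rewrite sumEFin lee_fin.
elim: n => [|n IH]; first by rewrite big_geq.
rewrite big_nat_recl// expr0 invr1.
under eq_bigr do rewrite exprS invfM; rewrite -mulr_sumr.
by move: IH; lra.
Qed.

Lemma pow2_unbounded (R : realType) (x : \bar R) :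
  (forall n, (2 ^+ n)%:E <= x)%E -> x = +oo%E.
Proof.
case: x => [r|//|] x_ge; last by have := x_ge 0.
have r0 : 0 <= r by have := x_ge 0; rewrite lee_fin expr0; exact/le_trans/ler01.
have := x_ge (Num.bound r); rewrite lee_fin leNgt => /negP[].
by rewrite (lt_le_trans (archi_boundP r0))// -natrX ler_nat ltnW// ltn_expl.
Qed.

(** * Interleaving a sequence of sequences *)

Section pairing.

Lemma ex_pairing : exists e : nat -> nat * nat, bijective e.
Proof.
have := card_nat2; rewrite card_eq_sym => /card_set_bijP[f fb].
by exists f; rewrite -setTT_bijective.
Qed.

Definition unpair : nat -> nat * nat := projT1 (cid ex_pairing).

Lemma unpair_bij : bijective unpair.
Proof. exact: projT2 (cid ex_pairing). Qed.

(** All rows are listed along a fixed bijection between [nat] and [nat * nat]; the order is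
    immaterial for sums of nonnegative terms. *)
Definition concat (T : Type) (x : nat -> nat -> T) : nat -> T :=
  fun m => x (unpair m).1 (unpair m).2.

(** Tonelli for nonnegative terms: with the same exponent inside and outside, the inner roots cancel
    and only a double sum remains. *)
Lemma lp_concat (R : realType) (p : R) (a : nat -> nat -> \bar R) : (0 < p)%R ->
  lp p (concat a) = lp p (fun i => lp p (a i)).
Proof.
move=> p0; congr (_ `^ _)%E.
under [RHS]eq_eseriesr do rewrite lp_power ?gt_eqF//.
rewrite /power_sum [LHS]nneseries_esumT; last by move=> *; exact: poweR_ge0.
rewrite [RHS]nneseries_esumT; last by move=> *; exact: power_sum_ge0.
under [RHS]eq_esum.
  move=> i _; rewrite /power_sum nneseries_esumT; last by move=> *; exact: poweR_ge0.
  over.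
rewrite esum_esum; last by move=> *; exact: poweR_ge0.
rewrite (_ : _ `*`` _ = [set: nat * nat]); last by apply/seteqP; split.
rewrite (reindex_esum [set: nat] [set: nat * nat] unpair)//.
by rewrite setTT_bijective; exact: unpair_bij.
Qed.

End pairing.

(** * Real-valued norms and continuous linear operators *)

Section real_scalars.
Variables (R : realType) (K : scalar_kind).

(** Norms are valued in the scalar field. This embedding, inverse to [scalar_re] on nonnegative
    scalars, turns their inequalities into real ones, so that after this section only the
    Hahn-Banach argument distinguishes the two fields. *)
Definition real_scalar : R -> scalars R K :=
  match K return R -> scalars R K with
  | RealScalars => id
  | ComplexScalars => fun x => (x%:C)%C
  end.

Lemma real_scalarD a b : real_scalar (a + b) = real_scalar a + real_scalar b.
Proof. by rewrite /real_scalar; case: K => //; rewrite rmorphD. Qed.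

Lemma real_scalarN a : real_scalar (- a) = - real_scalar a.
Proof. by rewrite /real_scalar; case: K => //; rewrite rmorphN. Qed.

Lemma real_scalarM a b : real_scalar (a * b) = real_scalar a * real_scalar b.
Proof. by rewrite /real_scalar; case: K => //; rewrite rmorphM. Qed.

Lemma real_scalar0 : real_scalar 0 = 0.
Proof. by rewrite /real_scalar; case: K. Qed.

Lemma real_scalar1 : real_scalar 1 = 1.
Proof. by rewrite /real_scalar; case: K. Qed.

Lemma ler_real_scalar a b : (real_scalar a <= real_scalar b) = (a <= b).
Proof. by rewrite /real_scalar; case: K => //; rewrite lecR. Qed.

Lemma ltr_real_scalar a b : (real_scalar a < real_scalar b) = (a < b).
Proof. by rewrite /real_scalar; case: K => //; rewrite ltcR. Qed.

Lemma real_scalarK a : scalar_re (real_scalar a) = a.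
Proof. by rewrite /real_scalar /scalar_re; case: K. Qed.

Lemma real_scalar_ge0 (z : scalars R K) : 0 <= z ->
  real_scalar (scalar_re z) = z.
Proof.
rewrite /real_scalar /scalar_re; case: K z => //= -[x y].
by rewrite lecE /= => /andP[/eqP ->].
Qed.

Lemma real_scalar_norm a : `|real_scalar a| = real_scalar `|a|.
Proof.
by rewrite /real_scalar; case: K => //=; rewrite normc_def/= expr0n/= addr0 sqrtr_sqr.
Qed.

Section rnorm.
Variable X : normedModType (scalars R K).
Implicit Types (x y : X).

Lemma rnormE x : real_scalar (rnorm x) = `|x|.
Proof. by rewrite /rnorm real_scalar_ge0. Qed.

Lemma rnorm_ge0 x : 0 <= rnorm x.
Proof. by rewrite -ler_real_scalar real_scalar0 rnormE. Qed.

Lemma rnormD x y : rnorm (x + y) <= rnorm x + rnorm y.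
Proof. by rewrite -ler_real_scalar real_scalarD !rnormE ler_normD. Qed.

Lemma rnormN x : rnorm (- x) = rnorm x.
Proof. by rewrite /rnorm normrN. Qed.

Lemma rnormB x y : rnorm (x - y) = rnorm (y - x).
Proof. by rewrite /rnorm distrC. Qed.

Lemma rnorm0 : rnorm (0 : X) = 0.
Proof. by rewrite /rnorm normr0 -real_scalar0 real_scalarK. Qed.

Lemma rnorm0_eq0 x : rnorm x = 0 -> x = 0.
Proof. by move=> x0; apply/normr0_eq0; rewrite -rnormE x0 real_scalar0. Qed.

Lemma rnorm_eq0 x : (rnorm x == 0) = (x == 0).
Proof. by apply/eqP/eqP => [/rnorm0_eq0//|->]; exact: rnorm0. Qed.

Lemma rnorm_gt0 x : (0 < rnorm x) = (x != 0).
Proof. by rewrite lt0r rnorm_eq0 rnorm_ge0 andbT. Qed.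

End rnorm.

Lemma rnorm_scalar (a : R) : rnorm (real_scalar a : scalar_space R K) = `|a|.
Proof. by rewrite /rnorm [X in scalar_re X]real_scalar_norm real_scalarK. Qed.

Lemma rnorm1 : rnorm (1 : scalar_space R K) = 1.
Proof. by rewrite -real_scalar1 rnorm_scalar normr1. Qed.

Lemma rnormZ (X : normedModType (scalars R K)) (a : scalars R K) (x : X) :
  rnorm (a *: x) = rnorm (a : scalar_space R K) * rnorm x.
Proof.
have : real_scalar (rnorm (a *: x)) =
    real_scalar (rnorm (a : scalar_space R K) * rnorm x).
  by rewrite real_scalarM !rnormE normrZ.
by move=> /(congr1 (@scalar_re R K)); rewrite !real_scalarK.
Qed.

Lemma rnormM (a b : scalar_space R K) : rnorm (a * b) = rnorm a * rnorm b.
Proof. exact: (rnormZ (a : scalars R K) b). Qed.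

Lemma rnormV (a : scalar_space R K) : rnorm (a^-1 : scalar_space R K) = (rnorm a)^-1.
Proof.
have [->|a0] := eqVneq a 0; first by rewrite invr0 rnorm0 invr0.
by apply: (mulIf (x := rnorm a)); rewrite ?rnorm_eq0// -rnormM !mulVf ?rnorm_eq0 ?rnorm1.
Qed.

End real_scalars.
#[global] Hint Extern 0 (is_true (0 <= rnorm _)) => solve [exact: rnorm_ge0] : core.

Section cont_linear.
Variables (R : realType) (K : scalar_kind).
Implicit Types (U V X Y : banach R K).

Lemma linearPack U X (T : U -> X) : linear T ->
  exists f : {linear U -> X}, T = f.
Proof.
move=> lT.
pose f : {linear U -> X} := HB.pack T (GRing.isLinear.Build _ _ _ _ T lT).
by exists f.
Qed.

Lemma cont_linearP U X (T : U -> X) : linear T ->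
  (continuous T <-> exists2 M, 0 <= M & forall u, rnorm (T u) <= M * rnorm u).
Proof.
move=> /linearPack[f ->]; split=> [/linear_bounded_continuous/linear_boundedP|[M M0 fM]].
  move=> /pinfty_ex_gt0[M M0 fM]; exists (scalar_re M) => [|u].
    by rewrite -(ler_real_scalar K) real_scalar0 real_scalar_ge0 ltW.
  by rewrite -(ler_real_scalar K) real_scalarM !rnormE real_scalar_ge0 ?fM// ltW.
apply/linear_bounded_continuous/linear_boundedP; near=> r => u.
rewrite -!rnormE (@le_trans _ _ (real_scalar K (M * rnorm u)))// ?ler_real_scalar//.
rewrite real_scalarM rnormE ler_wpM2r//.
near: r; apply: nbhs_pinfty_ge; apply: ger0_real.
by rewrite -real_scalar0 ler_real_scalar.
Unshelve. all: by end_near. Qed.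

Lemma cont_linear_bound U X (T : U -> X) (M : R) : linear T ->
  (forall u, rnorm (T u) <= M * rnorm u) -> cont_linear T.
Proof.
move=> lT TM; split=> //; apply/cont_linearP => //; exists `|M| => // u.
by rewrite (le_trans (TM u))// ler_wpM2r// ler_norm.
Qed.

Section operator_norm.
Variables (U X : banach R K) (T : U -> X).
Hypothesis cT : cont_linear T.

Lemma cont_linearD u v : T (u + v) = T u + T v.
Proof. by case: cT => /linearPack[f ->] _; rewrite linearD. Qed.

Lemma cont_linearB u v : T (u - v) = T u - T v.
Proof. by case: cT => /linearPack[f ->] _; rewrite linearB. Qed.

Lemma cont_linearZ a u : T (a *: u) = a *: T u.
Proof. by case: cT => /linearPack[f ->] _; rewrite linearZ. Qed.

Lemma cont_linear0 : T 0 = 0.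
Proof. by rewrite -(subrr 0) cont_linearB subrr. Qed.

Lemma opnorm_ge0 : (0 <= opnorm T)%E.
Proof.
apply: ereal_sup_ubound; exists 0; first by rewrite /= rnorm0.
by rewrite cont_linear0 rnorm0.
Qed.

Lemma opnorm_fin : opnorm T \is a fin_num.
Proof.
have [lT conT] := cT; have [M M0 TM] := (cont_linearP lT).1 conT.
rewrite ge0_fin_numE ?opnorm_ge0//; apply: (@le_lt_trans _ _ M%:E); last exact: ltry.
apply: ge_ereal_sup => _ [u /= u1 <-]; rewrite lee_fin (le_trans (TM u))//.
by rewrite ler_piMr.
Qed.

Lemma rnorm_le_opnorm u : rnorm (T u) <= fine (opnorm T) * rnorm u.
Proof.
have [->|u0] := eqVneq u 0; first by rewrite cont_linear0 !rnorm0 mulr0.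
have nu0 : 0 < rnorm u by rewrite rnorm_gt0.
rewrite -ler_pdivrMr// -lee_fin fineK ?opnorm_fin//.
apply: ereal_sup_ubound; exists (real_scalar K (rnorm u)^-1 *: u) => /=.
  by rewrite rnormZ rnorm_scalar ger0_norm ?invr_ge0// mulVf// gt_eqF.
by rewrite (cont_linearZ) rnormZ rnorm_scalar ger0_norm ?invr_ge0// mulrC.
Qed.

Lemma lee_opnorm u : ((rnorm (T u))%:E <= opnorm T * (rnorm u)%:E)%E.
Proof. by rewrite -(fineK opnorm_fin) -EFinM lee_fin rnorm_le_opnorm. Qed.

End operator_norm.

Lemma opnorm_le U X (T : U -> X) (M : R) : 0 <= M ->
  (forall u, rnorm (T u) <= M * rnorm u) -> (opnorm T <= M%:E)%E.
Proof.
move=> M0 TM; apply: ge_ereal_sup => _ [u /= u1 <-].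
by rewrite lee_fin (le_trans (TM u))// ler_piMr.
Qed.

Lemma opnorm_le_fin U X (T : U -> X) (M : \bar R) : (0 <= M)%E -> M \is a fin_num ->
  (forall u, ((rnorm (T u))%:E <= M * (rnorm u)%:E)%E) -> (opnorm T <= M)%E.
Proof.
move=> M0 Mf; rewrite -(fineK Mf) => TM; apply: opnorm_le; first exact: fine_ge0.
by move=> u; rewrite -lee_fin EFinM.
Qed.

Lemma opnorm_eq0 U X (T : U -> X) : cont_linear T -> opnorm T = 0%E ->
  forall u, T u = 0.
Proof.
move=> cT T0 u; apply: rnorm0_eq0; apply/eqP; rewrite eq_le rnorm_ge0 andbT.
by rewrite (le_trans (rnorm_le_opnorm cT u))// T0 mul0r.
Qed.

Lemma cont_linear_comp U V X (S : U -> V) (T : V -> X) :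
  cont_linear S -> cont_linear T -> cont_linear (T \o S).
Proof.
move=> cS cT; apply: (@cont_linear_bound _ _ _ (fine (opnorm T) * fine (opnorm S))).
  by move=> a u v /=; rewrite cont_linearD// cont_linearZ// cont_linearD// cont_linearZ.
move=> u /=; rewrite (le_trans (rnorm_le_opnorm cT _))// -mulrA ler_wpM2l//.
  exact/fine_ge0/opnorm_ge0.
exact: rnorm_le_opnorm.
Qed.

Lemma opnorm_comp U V X (S : U -> V) (T : V -> X) :
  cont_linear S -> cont_linear T -> (opnorm (T \o S) <= opnorm T * opnorm S)%E.
Proof.
move=> cS cT; apply: opnorm_le_fin.
- by rewrite mule_ge0// opnorm_ge0.
- by rewrite fin_numM// opnorm_fin.
- move=> u; rewrite (le_trans (lee_opnorm cT _))// -muleA lee_wpmul2l ?opnorm_ge0//.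
  exact: lee_opnorm.
Qed.

Lemma cont_linear_id U : cont_linear (@id U).
Proof. by apply: (@cont_linear_bound _ _ _ 1) => // u; rewrite mul1r. Qed.

Lemma cont_linear_cst0 U X : cont_linear ((fun=> 0) : U -> X).
Proof.
apply: (@cont_linear_bound _ _ _ 0) => [a u v|u]; first by rewrite scaler0 addr0.
by rewrite rnorm0 mul0r.
Qed.

Lemma cont_linear_add U X (S T : U -> X) : cont_linear S -> cont_linear T ->
  cont_linear (fun u => S u + T u).
Proof.
move=> cS cT; apply: (@cont_linear_bound _ _ _ (fine (opnorm S) + fine (opnorm T))).
  move=> a u v; rewrite (cont_linearD cS) (cont_linearD cT).
  rewrite (cont_linearZ cS) (cont_linearZ cT).
  by rewrite scalerDr addrACA.
by move=> u; rewrite (le_trans (rnormD _ _))// mulrDl lerD// rnorm_le_opnorm.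
Qed.

Lemma cont_linear_scale U X (a : scalars R K) (T : U -> X) : cont_linear T ->
  cont_linear (fun u => a *: T u).
Proof.
move=> cT; apply: (@cont_linear_bound _ _ _
  (rnorm (a : scalar_space R K) * fine (opnorm T))).
  by move=> b u v; rewrite (cont_linearD cT) (cont_linearZ cT) scalerDr !scalerA mulrC.
by move=> u; rewrite rnormZ -mulrA ler_wpM2l// rnorm_le_opnorm.
Qed.

Lemma opnorm_scale U X (a : scalars R K) (T : U -> X) : cont_linear T ->
  (opnorm (fun u => a *: T u) <= (rnorm (a : scalar_space R K))%:E * opnorm T)%E.
Proof.
move=> cT; apply: opnorm_le_fin.
- by rewrite mule_ge0 ?opnorm_ge0 ?lee_fin.
- by rewrite fin_numM ?opnorm_fin.
- by move=> u; rewrite rnormZ EFinM -muleA lee_wpmul2l ?lee_fin// lee_opnorm.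
Qed.

Lemma cont_linear_sub U X (S T : U -> X) : cont_linear S -> cont_linear T ->
  cont_linear (fun u => S u - T u).
Proof.
move=> cS cT; have := cont_linear_add cS (cont_linear_scale (-1) cT).
by congr (cont_linear _); apply/funext => u; rewrite scaleN1r.
Qed.

Lemma cont_linear_rank1 X (x : X) :
  cont_linear (fun c : scalar_space R K => (c : scalars R K) *: x).
Proof.
apply: (@cont_linear_bound _ _ _ (rnorm x)) => [a b c|c].
  by rewrite scalerDl scalerA.
by rewrite rnormZ mulrC.
Qed.

Lemma opnorm_id : opnorm (@id (scalar_space R K)) = 1%E.
Proof.
apply/eqP; rewrite eq_le; apply/andP; split.
  by apply: opnorm_le => // u; rewrite mul1r.
by apply: ereal_sup_ubound; exists 1 => /=; rewrite rnorm1.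
Qed.

Lemma banach_complete X (x : nat -> X) :
  (forall e : R, 0 < e -> exists N, forall m n, (N <= m)%N -> (N <= n)%N ->
     rnorm (x m - x n) < e) ->
  exists l : X, forall e : R, 0 < e -> exists N, forall n, (N <= n)%N ->
     rnorm (x n - l) < e.
Proof.
move=> xC.
(* Filters use tolerances in the scalar field; a positive scalar is the image of a positive real
   number. *)
have pos (e : scalars R K) : 0 < e -> 0 < scalar_re e /\ real_scalar K (scalar_re e) = e.
  move=> e0; have eE := real_scalar_ge0 (ltW e0).
  by split=> //; rewrite -(ltr_real_scalar K) real_scalar0 eE.
have : cvg (x @ \oo).
  apply: cauchy_cvg; apply: cauchy_exP => e /pos[e0 eE].
  have [N xN] := xC _ e0; exists (x N); exists N => // n /= Nn.
  by rewrite -ball_normE/= -rnormE -eE ltr_real_scalar xN.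
move=> /cvg_ex[l /cvgrPdist_lt xl]; exists l => e e0.
have [N _ xN] : \forall n \near \oo, `|l - x n| < real_scalar K e.
  by apply: xl; rewrite -real_scalar0 ltr_real_scalar.
exists N => n Nn; have := xN n Nn; rewrite /= -rnormE ltr_real_scalar.
by rewrite rnormB.
Qed.

Lemma rnorm_le_lim X (x : nat -> X) (l : X) (y : X) (c : R) (n0 : nat) :
  (forall e : R, 0 < e -> exists N, forall n, (N <= n)%N -> rnorm (x n - l) < e) ->
  (forall n, (n0 <= n)%N -> rnorm (x n - y) <= c) -> rnorm (l - y) <= c.
Proof.
move=> xl xy; apply/ler_addgt0Pr => e e0; have [N xN] := xl e e0.
pose n := maxn N n0; rewrite -(subrKA (x n)) addrC (le_trans (rnormD _ _))// lerD//.
  by rewrite xy// leq_maxr.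
by rewrite rnormB ltW// xN// leq_maxl.
Qed.

(* Pointwise convergence suffices: norm estimates follow by rnorm_le_lim. *)
Lemma cont_linear_lim U X (T : nat -> U -> X) :
  (forall n, cont_linear (T n)) ->
  (forall e : R, 0 < e -> exists N, forall m n, (N <= m)%N -> (N <= n)%N ->
     forall u, rnorm (T m u - T n u) <= e * rnorm u) ->
  exists2 S, cont_linear S & forall u (e : R), 0 < e ->
     exists N, forall n, (N <= n)%N -> rnorm (T n u - S u) < e.
Proof.
move=> cT TC.
have : forall u, exists l : X, forall e : R, 0 < e -> exists N, forall n, (N <= n)%N ->
     rnorm (T n u - l) < e.
  move=> u; apply: banach_complete => e e0.
  have d0 : 0 < e / (rnorm u + 1) by rewrite divr_gt0// ltr_pwDr.
  have [N TN] := TC _ d0; exists N => m n Nm Nn.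
  rewrite (le_lt_trans (TN m n Nm Nn u))// mulrAC ltr_pdivrMr ?ltr_pwDr//.
  by rewrite ltr_pM2l// ltrDl.
move=> /choice[S TS]; exists S => //.
(* Beyond [N] the operators differ by at most 1 in norm, so [S] stays within distance 1 of [T N]. *)
have [N TN] := TC 1 ltr01; apply: (@cont_linear_bound _ _ _ (1 + fine (opnorm (T N)))).
  move=> a u v; apply/eqP; rewrite -subr_eq0 -rnorm_eq0 eq_le rnorm_ge0 andbT.
  apply/ler_addgt0Pr => e e0; rewrite add0r.
  (* Three approximation errors enter the linearity defect of [S], with weights 1, [c] and 1; hence
     the divisor [c + 2]. *)
  pose c := rnorm (a : scalar_space R K).
  have d0 : 0 < e / (c + 2) by rewrite divr_gt0// ltr_wpDl// rnorm_ge0.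
  have [N1 T1] := TS (a *: u + v) _ d0; have [N2 T2] := TS u _ d0.
  have [N3 T3] := TS v _ d0; pose n := maxn N1 (maxn N2 N3).
  have := T1 n (leq_maxl _ _).
  rewrite (cont_linearD (cT n)) (cont_linearZ (cT n)) rnormB => h1.
  have h2 : rnorm (T n u - S u) < e / (c + 2).
    by apply: T2; rewrite !leq_max leqnn orbT.
  have h3 : rnorm (T n v - S v) < e / (c + 2).
    by apply: T3; rewrite !leq_max leqnn !orbT.
  rewrite (_ : S (a *: u + v) - (a *: S u + S v) =
    (S (a *: u + v) - (a *: T n u + T n v)) + (a *: (T n u - S u) + (T n v - S v))).
    apply: (le_trans (rnormD _ _)).
    have -> : e = e / (c + 2) + (c * (e / (c + 2)) + e / (c + 2)).
      have : e = e / (c + 2) * (c + 2).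
        by rewrite mulfVK// gt_eqF// ltr_wpDl// rnorm_ge0.
      by move: (e / (c + 2)) => d {1}->; ring.
    apply: lerD; first exact: ltW.
    apply: (le_trans (rnormD _ _)); rewrite rnormZ lerD ?(ltW h3)//.
    by rewrite ler_wpM2l ?rnorm_ge0// ltW.
  by rewrite scalerBr [X in _ = _ + X]addrACA -opprD addrA subrK.
move=> u; rewrite mulrDl -[S u](subrK (T N u)) (le_trans (rnormD _ _))// lerD//.
  by apply: (rnorm_le_lim (TS u) (n0 := N)) => n Nn; exact: TN.
exact: rnorm_le_opnorm.
Qed.

End cont_linear.

(** * The Hahn-Banach theorem *)

Section hahn_banach.
Variables (R : realType) (K : scalar_kind) (X : banach R K).
Local Notation "t *' x" := (real_scalar K t *: x) (at level 40).

(* Graphs of real-linear functionals dominated by the norm; the last clause lets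
   the empty graph in, as required for unions of empty chains in Zorn's lemma. *)
Definition dominated_graph (x0 : X) : set (set (X * R)) := [set G | [/\
  forall z w, G z -> G w -> G (z.1 + w.1, z.2 + w.2),
  forall t z, G z -> G (t *' z.1, t * z.2),
  forall z, G z -> z.2 <= rnorm z.1 &
  forall z, G z -> G (x0, rnorm x0)]].

Lemma dominated_graph_extend (x0 : X) (G : set (X * R)) (y : X) :
  dominated_graph x0 G -> G !=set0 ->
  exists2 B, dominated_graph x0 B & G `<=` B /\ exists c, B (y, c).
Proof.
move=> [Gadd Gscale Gdom Gx0] [z0 Gz0].
(* The value [c] at [y] has to satisfy [z.2 - rnorm (z.1 - y) <= c <= rnorm (w.1 + y) - w.2] for all
   [z], [w] in [G]. By [LU] every left side is below every right side, so the supremum of the left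
   sides fits. *)
pose L := [set z.2 - rnorm (z.1 - y) | z in G]; pose c := sup L.
have G0 : G (0, 0).
  by have := Gscale 0 _ Gz0; rewrite real_scalar0 scale0r mul0r.
have LU z w : G z -> G w -> z.2 - rnorm (z.1 - y) <= rnorm (w.1 + y) - w.2.
  move=> Gz Gw; have := Gdom _ (Gadd _ _ Gz Gw) => /=.
  have := rnormD (z.1 - y) (w.1 + y).
  by rewrite addrACA addNr addr0; lra.
have cU w : G w -> c <= rnorm (w.1 + y) - w.2.
  move=> Gw; apply: ge_sup; first by exists (z0.2 - rnorm (z0.1 - y)), z0.
  by move=> _ [z Gz <-]; exact: LU.
have cL z : G z -> z.2 - rnorm (z.1 - y) <= c.
  move=> Gz; apply: ub_le_sup; last by exists z.
  by exists (rnorm (0 + y) - 0) => _ [w Gw <-]; exact: (LU w (0, 0)).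
exists [set (z.1 + t *' y, z.2 + t * c) | z in G & t in [set: R]]; last first.
  split.
    move=> z Gz; exists z => //; exists 0 => //.
    by rewrite real_scalar0 scale0r mul0r !addr0 -surjective_pairing.
  exists c; exists (0, 0) => //; exists 1 => //=.
  by rewrite real_scalar1 scale1r mul1r !add0r.
split.
- move=> _ _ [z Gz [t _ <-]] [w Gw [u _ <-]].
  exists (z.1 + w.1, z.2 + w.2); first exact: Gadd.
  exists (t + u) => //=; rewrite real_scalarD scalerDl mulrDl.
  by congr (_, _); rewrite addrACA.
- move=> u _ [z Gz [t _ <-]]; exists (u *' z.1, u * z.2); first exact: Gscale.
  by exists (u * t) => //=; rewrite scalerDr scalerA real_scalarM mulrDr mulrA.
(* Dividing by the absolute value of [t] reduces to the increments [y] and [- y]: the lower bound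
   [cL] serves [t < 0], the upper bound [cU] serves [t > 0]. *)
- move=> _ [z Gz [t _ <-]] /=; have [t0|t0|->] := ltrgtP t 0.
  + have zE : z.1 + t *' y = - t *' ((- t)^-1 *' z.1 - y).
      rewrite scalerBr scalerA -real_scalarM mulfV ?oppr_eq0 ?lt_eqF//.
      by rewrite real_scalar1 scale1r real_scalarN scaleNr opprK.
    have := cL _ (Gscale (- t)^-1 _ Gz) => /=.
    rewrite zE rnormZ rnorm_scalar gtr0_norm ?oppr_gt0//; set n := rnorm _ => h.
    have -> : z.2 = - t * ((- t)^-1 * z.2) by rewrite mulVKf// oppr_eq0 lt_eqF.
    by rewrite -subr_ge0; move: h; set a := _ * z.2; nra.
  + have zE : z.1 + t *' y = t *' (t^-1 *' z.1 + y).
      rewrite scalerDr scalerA -real_scalarM mulfV ?gt_eqF//.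
      by rewrite real_scalar1 scale1r.
    have := cU _ (Gscale t^-1 _ Gz) => /=.
    rewrite zE rnormZ rnorm_scalar gtr0_norm//; set n := rnorm _ => h.
    have -> : z.2 = t * (t^-1 * z.2) by rewrite mulVKf// gt_eqF.
    by rewrite -subr_ge0; move: h; set a := _ * z.2; nra.
  + by rewrite real_scalar0 scale0r mul0r !addr0; exact: Gdom.
- move=> _ _; exists (x0, rnorm x0); first exact: Gx0 Gz0.
  by exists 0 => //=; rewrite real_scalar0 scale0r mul0r !addr0.
Qed.

Lemma dominated_graph_line (x0 : X) :
  dominated_graph x0 [set (t *' x0, t * rnorm x0) | t in [set: R]].
Proof.
split.
- move=> _ _ [t _ <-] [u _ <-]; exists (t + u) => //=.
  by rewrite real_scalarD scalerDl mulrDl.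
- by move=> u _ [t _ <-]; exists (u * t) => //=; rewrite real_scalarM scalerA mulrA.
- by move=> _ [t _ <-] /=; rewrite rnormZ rnorm_scalar ler_wpM2r// ler_norm.
- by move=> _ _; exists 1 => //; rewrite real_scalar1 scale1r mul1r.
Qed.

Lemma real_hahn_banach (x0 : X) : exists f : X -> R, [/\
  forall x y, f (x + y) = f x + f y,
  forall t x, f (t *' x) = t * f x,
  forall x, f x <= rnorm x &
  f x0 = rnorm x0].
Proof.
have [F FP Ftot|G [GP Gmax]] := @Zorn_bigcup _ (dominated_graph x0).
  split.
  - move=> z w [A FA Az] [B FB Bw].
    have [AB|BA] := Ftot _ _ FA FB.
      by exists B => //; have [+ _ _ _] := FP _ FB; apply=> //; exact: AB.
    by exists A => //; have [+ _ _ _] := FP _ FA; apply=> //; exact: BA.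
  - by move=> t z [A FA Az]; exists A => //; have [_ + _ _] := FP _ FA; apply.
  - by move=> z [A FA Az]; have [_ _ + _] := FP _ FA; apply.
  - by move=> z [A FA Az]; exists A => //; have [_ _ _ +] := FP _ FA; apply; exact: Az.
(* Zorn could return the empty graph; the line through [x0] is a larger dominated graph, which
   excludes this. *)
have G_neq0 : G !=set0.
  apply/set0P/eqP => G0; apply: (Gmax _ _ (dominated_graph_line x0)).
  rewrite G0; split=> // /(_ (1 *' x0, 1 * rnorm x0)); apply.
  by exists 1.
have [z0 Gz0] := G_neq0; have [Gadd Gscale Gdom Gx0] := GP.
have Gtot y : exists c, G (y, c).
  have [B PB [GB [c Byc]]] := dominated_graph_extend y GP G_neq0.
  exists c; have [//|nG] := pselect (G (y, c)).
  by exfalso; apply: (Gmax B) => //; split=> // /(_ _ Byc).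
(* Domination forces the graph to be single-valued: two values over the same point put
   [(0, a' - b')] into [G], hence [a' - b' <= 0], and by symmetry equality. *)
have Gfun x a b : G (x, a) -> G (x, b) -> a = b.
  have le a' b' : G (x, a') -> G (x, b') -> a' <= b'.
    move=> Ga /(Gscale (-1)) Gb; have := Gdom _ (Gadd _ _ Ga Gb) => /=.
    by rewrite real_scalarN real_scalar1 scaleN1r subrr rnorm0 mulN1r subr_le0.
  by move=> Ga Gb; apply/eqP; rewrite eq_le !le.
have /choice[f Gf] := Gtot; exists f; split=> [x y|t x|x|].
- by apply: Gfun (Gf _) _; exact: Gadd (Gf x) (Gf y).
- by apply: Gfun (Gf _) _; exact: Gscale (Gf x).
- exact: Gdom (Gf x).
- exact: Gfun (Gf _) (Gx0 _ Gz0).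
Qed.

End hahn_banach.

Lemma hahn_banach (R : realType) (K : scalar_kind) (X : banach R K) (x0 : X) :
  exists g : X -> scalar_space R K,
    [/\ cont_linear g, (opnorm g <= 1)%E & rnorm x0 <= rnorm (g x0)].
Proof.
have [f [fD fZ f_le fx0]] := real_hahn_banach x0.
suff [g [lg gle gx0]] : exists g : X -> scalar_space R K,
    [/\ linear g, forall x, rnorm (g x) <= 1 * rnorm x & rnorm x0 <= rnorm (g x0)].
  by exists g; split=> //; [exact: cont_linear_bound gle|exact: opnorm_le gle].
case: K X x0 f fD fZ f_le fx0 => X x0 f fD fZ f_le fx0.
  exists f; split=> [a x y|x|]; first by rewrite fD fZ.
    rewrite mul1r /rnorm/= ler_norml f_le andbT lerNl.
    by have := f_le (- x); rewrite rnormN -scaleN1r fZ mulN1r.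
  by rewrite -fx0; exact: ler_norm.
have fi x : f ('i%C *: ('i%C *: x)) = - f x.
  rewrite scalerA (_ : 'i%C * 'i%C = real_scalar ComplexScalars (-1) :> R[i]).
    by rewrite fZ mulN1r.
  by rewrite -expr2 sqr_i /= rmorphN rmorph1.
(* The complex-linear functional with real part [f]: linearity over the complex numbers forces its
   imaginary part at [x] to be [- f ('i *: x)]. *)
pose g x : scalar_space R ComplexScalars := (f x +i* - f ('i%C *: x))%C.
have lg : linear g.
  move=> [p q] x y; rewrite /g.
  have aE : (p +i* q)%C =
      real_scalar ComplexScalars p + real_scalar ComplexScalars q * 'i%C.
    by apply/eqP; rewrite eq_complex /=; apply/andP; split; apply/eqP; ring.
  have f1 : f ((p +i* q)%C *: x) = p * f x + q * f ('i%C *: x).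
    by rewrite aE scalerDl -scalerA fD !fZ.
  have f2 : f ('i%C *: ((p +i* q)%C *: x)) = p * f ('i%C *: x) - q * f x.
    rewrite scalerA mulrC -scalerA aE scalerDl -scalerA fD !fZ fi.
    by rewrite mulrN.
  rewrite scalerDr !fD f1 f2; apply/eqP; rewrite eq_complex/=.
  by apply/andP; split; apply/eqP; ring.
have f_g x : f x <= rnorm (g x).
  rewrite -(ler_real_scalar ComplexScalars) rnormE (le_trans _ (normc_ge_Re _))//.
  by rewrite lecR ler_norm.
exists g; split=> //; last by rewrite -fx0.
move=> x; rewrite mul1r; have [->|gx0] := eqVneq (g x) 0; first by rewrite rnorm0.
(* Rotating [x] by a unimodular scalar makes [g x] real, hence equal to [f]. *)
pose w : scalars R ComplexScalars := real_scalar ComplexScalars (rnorm (g x)) / g x.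
have gw : g (w *: x) = real_scalar ComplexScalars (rnorm (g x)).
  have -> : g (w *: x) = w * g x by have [h ->] := linearPack lg; rewrite linearZ.
  exact: divfK.
have <- : rnorm (w *: x) = rnorm x.
  by rewrite rnormZ rnormM rnormV rnorm_scalar ger0_norm// mulfV ?mul1r ?rnorm_eq0.
by rewrite -[leLHS](real_scalarK ComplexScalars) -gw; exact: f_le.
Qed.

(** * Ideals defined by sequence classes *)

(* Composing with the projection x |-> x - f x *: x_n, where f is a continuous
   functional with f x_n = 1, lowers the rank by one without appealing to the
   continuity of coordinates. *)
Lemma finite_rank_ind (R : realType) (K : scalar_kind) (U X : banach R K)
    (P : (U -> X) -> Prop) :
  P (fun=> 0) ->
  (forall T g y, dual g -> P T -> P (fun u => T u + (g u : scalars R K) *: y)) ->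
  forall T, cont_linear T -> finite_rank T -> P T.
Proof.
move=> P0 PS T cT [n [x Tx]]; elim: n x T cT Tx => [|n IH] x T cT Tx.
  suff -> : T = (fun=> 0) by [].
  by apply/funext => u; have [c ->] := Tx u; rewrite big_ord0.
pose xn := x ord_max.
have [xn0|xn0] := eqVneq xn 0.
  apply: (IH (fun i => x (widen_ord (leqnSn n) i))) => // u.
  have [c Tu] := Tx u; exists (fun i => c (widen_ord (leqnSn n) i)).
  by rewrite Tu big_ord_recr/= -/xn xn0 scaler0 addr0.
have [g [cg _ gx]] := hahn_banach xn.
have gxn : (g xn : scalars R K) != 0.
  apply/eqP => g0; move: gx; rewrite g0 rnorm0 leNgt => /negP; apply.
  by rewrite rnorm_gt0.
pose f x : scalar_space R K := (g xn : scalars R K)^-1 *: g x.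
have cf : dual f := cont_linear_scale _ cg.
have fxn : f xn = 1 by rewrite /f; exact: mulVf.
have cfT : dual (f \o T) := cont_linear_comp cT cf.
have cQ : cont_linear (fun x : X => x - (f x : scalars R K) *: xn).
  apply: cont_linear_sub; first exact: cont_linear_id.
  exact: (cont_linear_comp cf (cont_linear_rank1 xn)).
pose S u := T u - (f (T u) : scalars R K) *: xn.
have cS : cont_linear S := cont_linear_comp cT cQ.
have -> : T = (fun u => S u + ((f \o T) u : scalars R K) *: xn).
  by apply/funext => u; rewrite /S subrK.
apply: PS => //; apply: (IH (fun i => x (widen_ord (leqnSn n) i) -
  (f (x (widen_ord (leqnSn n) i)) : scalars R K) *: xn)) => // u.
(* [Q] kills [xn], so applying it to the expansion of [T u] drops the last term and leaves a
   combination of the projected vectors. *)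
have [c Tu] := Tx u; exists (fun i => c (widen_ord (leqnSn n) i)).
have [Qlin _] := cQ; have [Q QE] := linearPack Qlin.
have Qx z : z - (f z : scalars R K) *: xn = Q z by rewrite -QE.
rewrite /S Qx Tu linear_sum big_ord_recr/= linearZ/= -/xn -Qx fxn scale1r subrr.
by rewrite scaler0 addr0; apply: eq_bigr => i _; rewrite linearZ/= Qx.
Qed.

Section sequence_class.
Variables (R : realType) (K : scalar_kind).
Local Open Scope ereal_scope.

(* The space attached to n is {x | n x < +oo}. *)
Record sequence_class (n : forall X : banach R K, X^nat -> \bar R) : Prop := {
  seq_ge0 : forall (X : banach R K) (x : X^nat), 0 <= n X x;
  seq_lin : forall (X Y : banach R K) (B : X -> Y) (x : X^nat),
    cont_linear B -> n Y (B \o x) <= opnorm B * n X x;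
  seq_add : forall (X : banach R K) (x y : X^nat),
    n X (fun j => (x j + y j)%R) <= n X x + n X y;
  seq_le_l1 : forall (X : banach R K) (x : X^nat),
    n X x <= \sum_(0 <= j <oo) (rnorm (x j))%:E;
  seq_term : forall (X : banach R K) (x : X^nat) j, (rnorm (x j))%:E <= n X x;
  seq_trunc : forall (X : banach R K) (x : X^nat) J,
    n X (trunc J x) <= n X x;
  seq_trunc_lim : forall (X : banach R K) (x : X^nat) c, 0 <= c ->
    (forall J, n X (trunc J x) <= c) -> n X x <= c;
  seq_concat_le : forall (X : banach R K) (x : nat -> X^nat),
    n X (concat x) <= \sum_(0 <= i <oo) n X (x i);
  seq_concat_ge : forall (X : banach R K) (x : nat -> X^nat) i,
    n X (x i) <= n X (concat x)
}.

Section theory.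
Variable n : forall X : banach R K, X^nat -> \bar R.
Hypothesis nC : sequence_class n.
Variable X : banach R K.
Implicit Types (x y : X^nat).

Lemma seqZ (a : scalars R K) x :
  n (fun j => (a *: x j)%R) <= (rnorm (a : scalar_space R K))%:E * n x.
Proof.
have ca := cont_linear_scale a (@cont_linear_id _ _ X).
apply: (le_trans (seq_lin nC x ca)); rewrite lee_wpmul2r ?(seq_ge0 nC)//.
by apply: opnorm_le => // u; rewrite rnormZ.
Qed.

Lemma seq_cst0 : n (fun=> 0%R : X) = 0.
Proof.
apply/eqP; rewrite eq_le (seq_ge0 nC) andbT (le_trans (seq_le_l1 nC _))//.
by rewrite eseries0// => i _ _; rewrite rnorm0.
Qed.

Lemma seq_normB x y : n (fun j => (x j - y j)%R) <= n x + n y.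
Proof.
have := seq_add nC x (fun j => (-1 *: y j)%R).
under eq_fun do rewrite scaleN1r.
move=> /le_trans; apply; rewrite leeD2l// (le_trans (seqZ (-1) y))//.
by rewrite rnormN rnorm1 mul1e.
Qed.

Lemma seq_single (z : X) : n (trunc 1 (fun=> z)) = (rnorm z)%:E.
Proof.
apply/eqP; rewrite eq_le; apply/andP; split.
  apply: (le_trans (seq_le_l1 nC _)); rewrite nneseries_recl//=.
    rewrite eseries0 ?adde0// => -[|i]// _ _; by rewrite /trunc/= rnorm0.
  by move=> i _; rewrite lee_fin rnorm_ge0.
exact: (seq_term nC (trunc 1 (fun=> z)) 0).
Qed.

Lemma seq_trunc_le_sum x J : n (trunc J x) <= \sum_(0 <= j < J) (rnorm (x j))%:E.
Proof.
apply: (le_trans (seq_le_l1 nC _)).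
rewrite (nneseries_split 0 J); last by move=> i _; rewrite lee_fin rnorm_ge0.
rewrite add0n ereal_series_cond [X in _ + X]eseries0 ?adde0; last first.
  by move=> i _ /andP[Ji _]; rewrite /trunc ltnNge Ji/= rnorm0.
by rewrite big_nat [leRHS]big_nat; apply: lee_sum => i /andP[_ iJ]; rewrite /trunc iJ.
Qed.

(** A truncation sees only [J] coordinates, so at one common index the truncated difference has
    l1-norm at most [e]; then [seq_trunc_lim] lets [J] grow. The divisor [J.+1] also covers
    [J = 0]. *)
Lemma seq_lsc (x : nat -> X^nat) y c n0 : 0 <= c ->
  (forall j (e : R), (0 < e)%R -> exists N, forall m, (N <= m)%N ->
     (rnorm (x m j - y j) < e)%R) ->
  (forall m, (n0 <= m)%N -> n (x m) <= c) -> n y <= c.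
Proof.
move=> c0 xy xc; apply: (seq_trunc_lim nC) => // J.
apply/lee_addgt0Pr => e e0.
have d0 : (0 < e / J.+1%:R)%R by rewrite divr_gt0// ltr0n.
have /choice[N xN] j := xy j _ d0.
pose m := maxn n0 (\max_(j < J) N j).
have -> : trunc J y = (fun j => trunc J (x m) j - trunc J (fun j => x m j - y j) j)%R.
  apply/funext => j; rewrite /trunc; case: ifP; rewrite ?subr0// => _.
  by rewrite opprB addrC subrK.
apply: (le_trans (seq_normB _ _)); apply: leeD.
  by rewrite (le_trans (seq_trunc nC _ _))// xc// leq_maxl.
apply: (le_trans (seq_trunc_le_sum _ _)).
apply: (@le_trans _ _ (\sum_(0 <= j < J) (e / J.+1%:R)%:E)); last first.
  rewrite sumEFin lee_fin sumr_const_nat subn0 -[(_ *+ J)%R]mulr_natr.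
  rewrite mulrAC ler_pdivrMr ?ltr0n//.
  by rewrite ler_wpM2l ?ler_nat// ltW.
rewrite !big_mkord; apply: lee_sum => i _; rewrite lee_fin ltW// xN//.
by rewrite /m leq_max; apply/orP; right; exact: (leq_bigmax i).
Qed.

End theory.

Definition seq_summing (E F : forall X : banach R K, X^nat -> \bar R)
    (U X : banach R K) : set (U -> X) :=
  [set T | cont_linear T /\ forall u, E U u < +oo -> F X (T \o u) < +oo].

Definition seq_summing_norm (E F : forall X : banach R K, X^nat -> \bar R)
    (U X : banach R K) (T : U -> X) : \bar R :=
  ereal_inf [set D%:E | D in [set D : R | (0 < D)%R /\
    forall u, E U u < +oo -> F X (T \o u) <= D%:E * E U u]].

(** * Operators mapping one sequence class into another *)

Section seq_summing.
Variables E F : forall X : banach R K, X^nat -> \bar R.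
Arguments E {X}.
Arguments F {X}.
Hypotheses (EC : sequence_class (@E)) (FC : sequence_class (@F)).
Local Notation I := (seq_summing (@E) (@F)).
Local Notation N := (seq_summing_norm (@E) (@F)).
Implicit Types U V X Y : banach R K.

Lemma seq_summing_norm_ge0 U X (T : U -> X) : 0 <= N T.
Proof. by apply/ereal_infP => _ [D [D0 _] <-]; rewrite lee_fin ltW. Qed.

(** The infimum runs over positive constants only, so a bound [c], possibly 0, is reached through
    [c + e]. *)
Lemma seq_summing_norm_le U X (T : U -> X) (c : R) : (0 <= c)%R ->
  (forall u, E u < +oo -> F (T \o u) <= c%:E * E u) -> N T <= c%:E.
Proof.
move=> c0 Tc; apply/lee_addgt0Pr => e e0; apply: ereal_inf_lbound.
exists (c + e)%R => //; split=> [|u Eu]; first by rewrite ltr_wpDl.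
apply: (le_trans (Tc u Eu)); rewrite lee_wpmul2r ?(seq_ge0 EC)// lee_fin lerDl.
exact: ltW.
Qed.

(** If [E u] vanished, every term of [u] would vanish by [seq_term], and the strict inequality would
    fail. Otherwise [u] is scaled to have [E]-norm at most [2 ^- n]. *)
Lemma seq_scale_small U X (T : U -> X) (u : U^nat) (n : nat) : cont_linear T ->
  E u < +oo -> (4 ^+ n)%:E * E u < F (T \o u) ->
  exists v : U^nat, E v <= (2 ^- n)%:E /\ (2 ^+ n)%:E <= F (T \o v).
Proof.
move=> cT Eu EF.
have [e eE] : exists e : R, E u = e%:E.
  by exists (fine (E u)); rewrite fineK// ge0_fin_numE ?(seq_ge0 EC).
have [e0|e0] := eqVneq e 0%R.
  exfalso; move: EF; rewrite eE e0 mule0 (_ : T \o u = fun=> 0%R) ?seq_cst0 ?ltxx//.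
  apply/funext => j /=; suff -> : u j = 0%R by rewrite cont_linear0.
  apply: rnorm0_eq0; apply/eqP; rewrite eq_le rnorm_ge0 andbT -lee_fin.
  by rewrite (le_trans (seq_term EC u j))// eE e0.
have {}e0 : (0 < e)%R by rewrite lt0r e0 -lee_fin -eE (seq_ge0 EC).
have p2 : (0 < 2 ^+ n :> R)%R by rewrite exprn_gt0.
pose t := (2 ^- n / e)%R; have t0 : (0 < t)%R by rewrite divr_gt0// invr_gt0.
have nt : rnorm (real_scalar K t : scalar_space R K) = t.
  by rewrite rnorm_scalar gtr0_norm.
have nVt : rnorm (real_scalar K t^-1%R : scalar_space R K) = t^-1%R.
  by rewrite rnorm_scalar gtr0_norm ?invr_gt0.
exists (fun j => real_scalar K t *: u j)%R; split.
  by rewrite (le_trans (seqZ EC _ _))// nt eE -EFinM lee_fin /t divfK ?gt_eqF.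
(* [seqZ] bounds only from above, so the lower bound for the scaled sequence comes from scaling back
   by the inverse of [t]. *)
have : F (T \o u) <= (t^-1%R)%:E * F (T \o (fun j => real_scalar K t *: u j)%R).
  have := seqZ FC (real_scalar K t^-1%R) (T \o (fun j => real_scalar K t *: u j)%R).
  rewrite nVt; apply: le_trans; rewrite le_eqVlt; apply/orP; left; apply/eqP.
  congr F; apply/funext => j /=; rewrite (cont_linearZ cT) scalerA -real_scalarM.
  by rewrite mulVf ?gt_eqF// real_scalar1 scale1r.
move=> /(lt_le_trans EF); rewrite eE -EFinM -lte_pdivrMl ?invr_gt0// invrK -EFinM.
move=> /ltW; apply: le_trans; rewrite lee_fin /t.
have -> : (2 ^- n / e * (4 ^+ n * e) = 2 ^+ n :> R)%R; last by [].
have -> : (4 = 2 * 2 :> R)%R by ring.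
rewrite exprMn; field.
by rewrite !gt_eqF.
Qed.

Lemma seq_summing_bounded U X (T : U -> X) : I T -> exists2 D : R, (0 < D)%R &
  forall u, E u < +oo -> F (T \o u) <= D%:E * E u.
Proof.
move=> [cT IT]; apply: contrapT => /forall2NP nb.
have : forall n, exists v : U^nat, E v <= (2 ^- n)%:E /\ (2 ^+ n)%:E <= F (T \o v).
  move=> n; case: (nb (4 ^+ n)%R); first by rewrite exprn_gt0.
  move=> /existsNP[u /not_implyP[Eu /negP]]; rewrite -ltNge => EF.
  exact: seq_scale_small EF.
move=> /choice[v vP].
have Ev : E (concat v) < +oo.
  apply: (le_lt_trans (seq_concat_le EC v)).
  apply: (@le_lt_trans _ _ (\sum_(0 <= n <oo) (2 ^- n)%:E)).
    by apply: lee_nneseries => [*|n _]; [exact: (seq_ge0 EC)|case: (vP n)].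
  exact: half_series_lty.
have := IT _ Ev; rewrite ltNge => /negP; apply.
have FE : T \o concat v = concat (fun n => T \o v n) by [].
rewrite (@pow2_unbounded _ (F (T \o concat v)))// => n.
by rewrite FE (le_trans _ (seq_concat_ge FC _ n))//; case: (vP n).
Qed.

Lemma seq_summing_norm_lty U X (T : U -> X) : I T -> N T < +oo.
Proof.
move=> /seq_summing_bounded[D D0 TD]; apply: (@le_lt_trans _ _ D%:E); last exact: ltry.
exact: (seq_summing_norm_le (ltW D0)).
Qed.

Lemma seq_summing_norm_fin U X (T : U -> X) : I T -> N T \is a fin_num.
Proof. by move=> IT; rewrite ge0_fin_numE ?seq_summing_norm_ge0 ?seq_summing_norm_lty. Qed.

(** The infimum is attained: for [E u > 0] every admissible constant bounds the quotient of the two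
    norms. For [E u = 0] one admissible constant, supplied by boundedness, already makes the left
    side vanish. *)
Lemma seq_summing_normP U X (T : U -> X) (u : U^nat) : I T -> E u < +oo ->
  F (T \o u) <= N T * E u.
Proof.
move=> IT Eu; have [D D0 TD] := seq_summing_bounded IT.
have [e eE] : exists e : R, E u = e%:E.
  by exists (fine (E u)); rewrite fineK// ge0_fin_numE ?(seq_ge0 EC).
have [e0|e0] := eqVneq e 0%R.
  by rewrite eE e0 mule0 (le_trans (TD u Eu))// eE e0 mule0.
have {}e0 : (0 < e)%R by rewrite lt0r e0 -lee_fin -eE (seq_ge0 EC).
rewrite eE muleC -lee_pdivrMl//; apply/ereal_infP => _ [C [C0 TC] <-].
by rewrite lee_pdivrMl// muleC -eE TC.
Qed.

(** Test on the one-term sequence [u, 0, 0, ...]. Thus the ideal norm dominates the operator norm,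
    which yields definiteness and the pointwise limit of a Cauchy sequence. *)
Lemma seq_summing_rnorm U X (T : U -> X) (u : U) : I T ->
  (rnorm (T u))%:E <= N T * (rnorm u)%:E.
Proof.
move=> IT; rewrite -(seq_single EC u).
apply: (le_trans (seq_term FC (T \o trunc 1 (fun=> u)) 0)).
by apply: seq_summing_normP => //; rewrite seq_single// ltry.
Qed.

Lemma seq_summing0 U X : I ((fun=> 0%R) : U -> X).
Proof.
split; first exact: cont_linear_cst0.
by move=> u _; rewrite (_ : _ \o u = fun=> 0%R)// seq_cst0.
Qed.

Lemma seq_summing_add U X (S T : U -> X) : I S -> I T ->
  I (fun u => S u + T u)%R.
Proof.
move=> [cS IS] [cT IT]; split=> [|u Eu]; first exact: cont_linear_add.
apply: (le_lt_trans (seq_add FC (S \o u) (T \o u))).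
by rewrite lte_add_pinfty ?IS ?IT.
Qed.

Lemma seq_summing_scale U X (a : scalars R K) (T : U -> X) : I T ->
  I (fun u => a *: T u)%R.
Proof.
move=> [cT IT]; split=> [|u Eu]; first exact: cont_linear_scale.
apply: (le_lt_trans (seqZ FC a (T \o u))).
by rewrite lte_mul_pinfty ?lee_fin ?IT.
Qed.

Lemma seq_summing_sub U X (S T : U -> X) : I S -> I T ->
  I (fun u => S u - T u)%R.
Proof.
move=> IS IT; have := seq_summing_add IS (seq_summing_scale (-1) IT).
by congr (I _); apply/funext => u; rewrite scaleN1r.
Qed.

Lemma seq_summing_normD U X (S T : U -> X) : I S -> I T ->
  N (fun u => S u + T u)%R <= N S + N T.
Proof.
move=> IS IT; have fS := seq_summing_norm_fin IS; have fT := seq_summing_norm_fin IT.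
rewrite -(fineK fS) -(fineK fT) -EFinD; apply: seq_summing_norm_le.
  by rewrite addr_ge0// fine_ge0// seq_summing_norm_ge0.
move=> u Eu; apply: (le_trans (seq_add FC (S \o u) (T \o u))).
rewrite EFinD ge0_muleDl ?lee_fin ?fine_ge0 ?seq_summing_norm_ge0// !fineK//.
by apply: leeD; exact: seq_summing_normP.
Qed.

Lemma seq_summing_normZ_le U X (a : scalars R K) (T : U -> X) : I T ->
  N (fun u => a *: T u)%R <= (rnorm (a : scalar_space R K))%:E * N T.
Proof.
move=> IT; have fT := seq_summing_norm_fin IT.
rewrite -(fineK fT) -EFinM; apply: seq_summing_norm_le.
  by rewrite mulr_ge0 ?rnorm_ge0 ?fine_ge0 ?seq_summing_norm_ge0.
move=> u Eu; apply: (le_trans (seqZ FC a (T \o u))).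
by rewrite EFinM -muleA lee_wpmul2l ?lee_fin ?rnorm_ge0// fineK// seq_summing_normP.
Qed.

Lemma seq_summing_normZ U X (a : scalars R K) (T : U -> X) : I T ->
  N (fun u => a *: T u)%R = (rnorm (a : scalar_space R K))%:E * N T.
Proof.
move=> IT; apply/eqP; rewrite eq_le seq_summing_normZ_le//=.
have [->|a0] := eqVneq a 0%R.
  by rewrite rnorm0 mul0e seq_summing_norm_ge0.
have na : (0 < rnorm (a : scalar_space R K))%R by rewrite rnorm_gt0.
rewrite -lee_pdivlMl// -rnormV.
have := seq_summing_normZ_le a^-1%R (seq_summing_scale a IT).
by under eq_fun do rewrite scalerA mulVf// scale1r.
Qed.

Lemma seq_summing_comp U V X Y (A : V -> U) (T : U -> X) (B : X -> Y) :
  cont_linear A -> I T -> cont_linear B -> I (B \o T \o A).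
Proof.
move=> cA [cT IT] cB; split=> [|v Ev].
  exact: (cont_linear_comp cA (cont_linear_comp cT cB)).
apply: (le_lt_trans (seq_lin FC (T \o A \o v) cB)).
rewrite -(fineK (opnorm_fin cB)) lte_mul_pinfty ?lee_fin ?fine_ge0 ?opnorm_ge0//.
apply: IT; apply: (le_lt_trans (seq_lin EC v cA)).
by rewrite -(fineK (opnorm_fin cA)) lte_mul_pinfty ?lee_fin ?fine_ge0 ?opnorm_ge0.
Qed.

Lemma seq_summing_norm_comp U V X Y (A : V -> U) (T : U -> X) (B : X -> Y) :
  cont_linear A -> I T -> cont_linear B ->
  N (B \o T \o A) <= opnorm B * N T * opnorm A.
Proof.
move=> cA IT cB.
have [[fA fB] fT] := (opnorm_fin cA, opnorm_fin cB, seq_summing_norm_fin IT).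
have [[A0 B0] T0] := (opnorm_ge0 cA, opnorm_ge0 cB, seq_summing_norm_ge0 T).
rewrite -(fineK fA) -(fineK fB) -(fineK fT) -!EFinM; apply: seq_summing_norm_le.
  by rewrite !mulr_ge0// fine_ge0.
move=> v Ev; rewrite !EFinM !fineK// -!muleA.
have EA := seq_lin EC v cA.
have EAv : E (A \o v) < +oo.
  apply: (le_lt_trans EA).
  by rewrite -(fineK fA) lte_mul_pinfty ?lee_fin ?fine_ge0.
apply: (le_trans (seq_lin FC (T \o A \o v) cB)); apply: lee_wpmul2l => //.
by apply: (le_trans (seq_summing_normP IT EAv)); apply: lee_wpmul2l.
Qed.

Lemma seq_summing_complete U X (T : nat -> U -> X) :
  (forall n, I (T n)) ->
  (forall e : R, (0 < e)%R ->
    \forall m & n \near \oo, N (fun u => T m u - T n u)%R < e%:E) ->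
  exists2 S, I S & N (fun u => T n u - S u)%R @[n --> \oo] --> 0.
Proof.
move=> IT TC.
have {}TC (e : R) : (0 < e)%R -> exists M, forall m n, (M <= m)%N -> (M <= n)%N ->
    N (fun u => T m u - T n u)%R < e%:E.
  move=> /TC[[A B] /= [[a _ aA] [b _ bB]] AB].
  exists (maxn a b) => m n; rewrite !geq_max => /andP[am _] /andP[_ bn].
  by apply: (AB (m, n)); split; [exact: aA|exact: bB].
have [||S cS TS] := @cont_linear_lim _ _ U X T.
- by move=> n; case: (IT n).
- move=> e /TC[M TM]; exists M => m n Mm Mn u.
  have := seq_summing_rnorm u (seq_summing_sub (IT m) (IT n)).
  rewrite -lee_fin EFinM => /le_trans; apply; rewrite lee_wpmul2r ?lee_fin ?rnorm_ge0//.
  exact/ltW/TM.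
(* For fixed [m] the sequences [T m u - T n u] tend coordinatewise to [T m u - S u], and [seq_lsc]
   carries the Cauchy bound over to this limit in [n]. *)
have TSF (e : R) : (0 < e)%R -> exists M, forall m, (M <= m)%N ->
    forall u, E u < +oo -> F ((fun u => T m u - S u)%R \o u) <= e%:E * E u.
  move=> e0; have [M TM] := TC e e0; exists M => m Mm u Eu.
  apply: (@seq_lsc (@F) FC X (fun n j => T m (u j) - T n (u j))%R _ _ M).
  - by rewrite mule_ge0 ?lee_fin ?(ltW e0)// (seq_ge0 EC).
  - move=> j d /(TS (u j))[k Tk]; exists k => n kn /=.
    by rewrite opprB addrC addrA subrK rnormB Tk.
  - move=> n Mn.
    apply: (le_trans (seq_summing_normP (seq_summing_sub (IT m) (IT n)) Eu)).
    by rewrite lee_wpmul2r ?(seq_ge0 EC)// ltW// TM.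
have IS : I S.
  (* [S] is [T M] minus the difference [T M - S], and both send [u] to a sequence of finite norm. *)
  split=> // u Eu; have [M TM] := TSF 1%R ltr01.
  have := seq_normB FC (T M \o u) ((fun u => T M u - S u)%R \o u).
  rewrite (_ : (fun j => _) = S \o u); last first.
    by apply/funext => j /=; rewrite opprB addrC subrK.
  move=> /le_lt_trans; apply; rewrite lte_add_pinfty//; first by case: (IT M) => _; apply.
  by apply: (le_lt_trans (TM M (leqnn M) u Eu)); rewrite mul1e.
exists S => //; apply/fine_cvgP; split.
  by apply: nearW => n; apply: seq_summing_norm_fin; exact: seq_summing_sub.
apply/cvgrPdist_le => e e0; have [M TM] := TSF e e0.
exists M => // n /= Mn; rewrite sub0r normrN ger0_norm ?fine_ge0 ?seq_summing_norm_ge0//.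
rewrite -lee_fin fineK; last exact/seq_summing_norm_fin/seq_summing_sub.
by apply: seq_summing_norm_le; [exact: ltW|exact: TM].
Qed.

Hypothesis EF : forall x : (scalar_space R K)^nat, F x <= E x.

Lemma seq_summing_finite_rank U X (T : U -> X) :
  cont_linear T -> finite_rank T -> I T.
Proof.
move: T; apply: finite_rank_ind => [|S g y cg IS].
  exact: seq_summing0.
apply: seq_summing_add => //; have cy := cont_linear_rank1 y.
split=> [|u Eu]; first exact: (cont_linear_comp cg cy).
apply: (le_lt_trans (seq_lin FC (g \o u) cy)).
rewrite -(fineK (opnorm_fin cy)) lte_mul_pinfty ?lee_fin ?fine_ge0 ?opnorm_ge0//.
apply: (le_lt_trans (EF _)); apply: (le_lt_trans (seq_lin EC u cg)).
by rewrite -(fineK (opnorm_fin cg)) lte_mul_pinfty ?lee_fin ?fine_ge0 ?opnorm_ge0.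
Qed.

(** The constant 1 in [EF] gives the upper bound; evaluation at the scalar 1 gives the lower one. *)
Lemma seq_summing_norm_id : N (@id (scalar_space R K)) = 1.
Proof.
have Iid : I (@id (scalar_space R K)).
  by split=> [|u]; [exact: cont_linear_id|exact/le_lt_trans/EF].
apply/eqP; rewrite eq_le; apply/andP; split.
  by apply: seq_summing_norm_le => // u _; rewrite mul1e; exact: EF.
by have := seq_summing_rnorm (1%R : scalar_space R K) Iid; rewrite rnorm1 mule1.
Qed.

Theorem seq_summing_banach_ideal : banach_ideal I N.
Proof.
split.
- split.
  + by move=> U X T [].
  + exact: seq_summing_finite_rank.
  + exact: seq_summing_add.
  + exact: seq_summing_scale.
  + by move=> V U X Y A T B; exact: seq_summing_comp.
- by move=> U X T IT; rewrite seq_summing_norm_ge0 seq_summing_norm_lty.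
- move=> U X T IT NT0; apply/funext => u; apply: rnorm0_eq0; apply/eqP.
  rewrite eq_le rnorm_ge0 andbT -lee_fin (le_trans (seq_summing_rnorm u IT))//.
  by rewrite NT0 mul0e.
- exact: seq_summing_normZ.
- exact: seq_summing_normD.
- exact: seq_summing_norm_id.
- by move=> V U X Y A T B; exact: seq_summing_norm_comp.
- exact: seq_summing_complete.
Qed.

End seq_summing.

End sequence_class.

(** * The classes of absolutely and weakly summable sequences *)

Section ell_class.
Variables (R : realType) (K : scalar_kind).
Local Open Scope ereal_scope.
Implicit Types X Y : banach R K.

Lemma trunc_comp (V W : nmodType) (f : V -> W) (x : V^nat) J : f 0%R = 0%R ->
  f \o trunc J x = trunc J (f \o x).
Proof. by move=> f0; apply/funext => j; rewrite /trunc/=; case: ifP. Qed.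

Lemma rnorm_trunc X (x : X^nat) J j :
  (rnorm (trunc J x j))%:E = if (j < J)%N then (rnorm (x j))%:E else 0.
Proof. by rewrite /trunc; case: ifP => // _; rewrite rnorm0. Qed.

Lemma ell_normE p X (x : X^nat) : ell_norm p x = lp p (fun j => (rnorm (x j))%:E).
Proof. by []. Qed.

Lemma ell_class (p : R) : (1 <= p)%R -> sequence_class (@ell_norm R K p).
Proof.
move=> p1; have p0 : (0 < p)%R by exact: lt_le_trans p1.
have n0 X (x : X) : 0 <= (rnorm x)%:E by rewrite lee_fin rnorm_ge0.
split; rewrite /=.
- by move=> X x; exact: lp_ge0.
- move=> X Y B x cB; rewrite -(fineK (opnorm_fin cB)) !ell_normE.
  rewrite -lpZ ?fine_ge0 ?opnorm_ge0//; apply: le_lp => // j.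
  by rewrite fineK ?opnorm_fin ?lee_opnorm.
- move=> X x y; rewrite !ell_normE.
  apply: (@le_trans _ _ (lp p (fun j => (rnorm (x j))%:E + (rnorm (y j))%:E))); last first.
    exact: lpD.
  by apply: le_lp => // j; rewrite -EFinD lee_fin rnormD.
- by move=> X x; exact: le_lp_series.
- by move=> X x j; exact: (le_lp_term j p0 (fun j => n0 X (x j))).
- by move=> X x J; apply: le_lp => // j; rewrite rnorm_trunc; case: ifP.
- move=> X x c c0 xc; apply: lp_le_trunc => // J.
  by under eq_fun do rewrite -rnorm_trunc; exact: xc.
- move=> X x; have -> : ell_norm p (concat x) = lp p (fun i => ell_norm p (x i)).
    exact: (lp_concat (fun i j => (rnorm (x i j))%:E) p0).
  by apply: le_lp_series => // i; exact: lp_ge0.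
- move=> X x i; have -> : ell_norm p (concat x) = lp p (fun i => ell_norm p (x i)).
    exact: (lp_concat (fun i j => (rnorm (x i j))%:E) p0).
  by apply: (@le_lp_term _ p (fun i => ell_norm p (x i))) => // j; exact: lp_ge0.
Qed.

Lemma ellP p X (x : X^nat) : (0 < p)%R -> (ell p x) <-> (ell_norm p x < +oo).
Proof. by move=> p0; rewrite ell_normE lp_lty// gt_eqF. Qed.

End ell_class.

Section ell_weak_class.
Variables (R : realType) (K : scalar_kind) (p : R).
Hypothesis p1 : 1 <= p.
Local Open Scope ereal_scope.
Implicit Types X Y : banach R K.
Let p0 : (0 < p)%R. Proof. exact: lt_le_trans p1. Qed.
Let C := @ell_class R K p p1.

Lemma ell_weak_norm_ub X (x : X^nat) (g : X -> scalar_space R K) : dual g ->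
  opnorm g <= 1 -> ell_norm p (g \o x) <= ell_weak_norm p x.
Proof. by move=> cg g1; apply: ereal_sup_ubound; exists g. Qed.

Lemma ell_weak_norm_leP X (x : X^nat) c :
  (forall g : X -> scalar_space R K, dual g -> opnorm g <= 1 ->
     ell_norm p (g \o x) <= c) -> ell_weak_norm p x <= c.
Proof. by move=> xc; apply: ge_ereal_sup => _ [g [cg g1] <-]; exact: xc. Qed.

Lemma ell_weak_norm_ge0 X (x : X^nat) : 0 <= ell_weak_norm p x.
Proof.
have c0 := @cont_linear_cst0 R K X (scalar_space R K).
apply: (le_trans _ (ell_weak_norm_ub x c0 _)); first exact: (seq_ge0 C).
by apply: opnorm_le => // u; rewrite rnorm0 mul1r rnorm_ge0.
Qed.

Lemma ell_norm_dual_le X (x : X^nat) (g : X -> scalar_space R K) : dual g ->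
  ell_norm p (g \o x) <= opnorm g * ell_weak_norm p x.
Proof.
move=> cg; have [g0|g0] := eqVneq (opnorm g) 0.
  rewrite g0 mul0e (_ : g \o x = fun=> 0%R) ?(seq_cst0 C)//.
  by apply/funext => j /=; exact: (opnorm_eq0 cg g0).
pose c := fine (opnorm g).
have c0 : (0 < c)%R.
  by rewrite fine_gt0// lt0e g0 opnorm_ge0// -ge0_fin_numE ?opnorm_fin ?opnorm_ge0.
pose h u : scalar_space R K := (real_scalar K c^-1%R *: g u)%R.
have ch : dual h := cont_linear_scale _ cg.
have h1 : opnorm h <= 1.
  apply: (le_trans (opnorm_scale _ cg)); rewrite rnorm_scalar gtr0_norm ?invr_gt0//.
  by rewrite -(fineK (opnorm_fin cg)) -EFinM mulVf// gt_eqF.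
have -> : g \o x = (fun j => real_scalar K c *: (h \o x) j)%R.
  apply/funext => j /=; rewrite /h scalerA -real_scalarM mulfV ?gt_eqF//.
  by rewrite real_scalar1 scale1r.
apply: (le_trans (seqZ C _ _)); rewrite rnorm_scalar gtr0_norm// fineK ?opnorm_fin//.
by rewrite lee_wpmul2l ?opnorm_ge0// ell_weak_norm_ub.
Qed.

(** Apart from [seq_term], which takes a norming functional from Hahn-Banach, the axioms come from
    the scalar sequences [g \o x], uniformly over functionals [g] of norm at most 1. *)
Lemma ell_weak_class : sequence_class (@ell_weak_norm R K p).
Proof.
split; rewrite /=.
- exact: ell_weak_norm_ge0.
- move=> X Y B x cB; apply: ell_weak_norm_leP => g cg g1.
  apply: (le_trans (ell_norm_dual_le x (cont_linear_comp cB cg))).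
  rewrite lee_wpmul2r ?ell_weak_norm_ge0// (le_trans (opnorm_comp cB cg))//.
  by rewrite -[leRHS]mul1e lee_wpmul2r ?opnorm_ge0.
- move=> X x y; apply: ell_weak_norm_leP => g cg g1.
  have -> : g \o (fun j => x j + y j)%R = (fun j => (g \o x) j + (g \o y) j)%R.
    by apply/funext => j /=; rewrite (cont_linearD cg).
  by apply: (le_trans (seq_add C _ _)); apply: leeD; exact: ell_weak_norm_ub.
- move=> X x; apply: ell_weak_norm_leP => g cg g1.
  apply: (le_trans (seq_le_l1 C _)); apply: lee_nneseries => j _.
    by rewrite lee_fin rnorm_ge0.
  apply: (le_trans (lee_opnorm cg _)); rewrite -[leRHS]mul1e.
  by rewrite lee_wpmul2r// lee_fin rnorm_ge0.
- move=> X x j; have [g [cg g1 gx]] := hahn_banach (x j).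
  apply: (le_trans _ (ell_weak_norm_ub x cg g1)).
  by apply: (le_trans _ (seq_term C (g \o x) j)); rewrite lee_fin.
- move=> X x J; apply: ell_weak_norm_leP => g cg g1.
  rewrite trunc_comp ?(cont_linear0 cg)//; apply: (le_trans (seq_trunc C _ _)).
  exact: ell_weak_norm_ub.
- move=> X x c c0 xc; apply: ell_weak_norm_leP => g cg g1.
  apply: (seq_trunc_lim C) => // J; rewrite -trunc_comp ?(cont_linear0 cg)//.
  by apply: (le_trans _ (xc J)); exact: ell_weak_norm_ub.
- move=> X x; apply: ell_weak_norm_leP => g cg g1.
  apply: (le_trans (seq_concat_le C (fun i => g \o x i))).
  apply: lee_nneseries => i _; first by move=> _; exact: (seq_ge0 C).
  exact: ell_weak_norm_ub.
- move=> X x i; apply: ell_weak_norm_leP => g cg g1.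
  apply: (le_trans (seq_concat_ge C (fun i => g \o x i) i)).
  exact: (ell_weak_norm_ub (concat x)).
Qed.

End ell_weak_class.

(** * The anisotropic class *)

Section ell_aniso_class.
Variables (R : realType) (K : scalar_kind) (s q r : R).
Hypotheses (s1 : 1 <= s) (q1 : 1 <= q) (r1 : 1 <= r) (rs : r <= s).
Local Open Scope ereal_scope.
Implicit Types X Y : banach R K.
Let s0 : (0 < s)%R. Proof. exact: lt_le_trans s1. Qed.
Let q0 : (0 < q)%R. Proof. exact: lt_le_trans q1. Qed.
Let r0 : (0 < r)%R. Proof. exact: lt_le_trans r1. Qed.
Let rnormE_ge0 X (x : X) : 0 <= (rnorm x)%:E. Proof. by rewrite lee_fin rnorm_ge0. Qed.

Definition dual_lp X (f : (X -> scalar_space R K)^nat) (z : X) : \bar R :=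
  lp s (fun k => (rnorm (f k z))%:E).

(** The mixed norm, [s] inside and [q] outside, of the matrix with entries [f k (x j)]. As an
    iterated [lp] norm it inherits monotonicity, Minkowski and interleaving from [lp]. *)
Definition aniso_lp X (f : (X -> scalar_space R K)^nat) (x : X^nat) : \bar R :=
  lp q (fun j => dual_lp f (x j)).

Lemma aniso_lpE X (f : (X -> scalar_space R K)^nat) (x : X^nat) :
  aniso_sum s q f x `^ q^-1 = aniso_lp f x.
Proof.
congr (_ `^ _); apply: eq_eseriesr => j _.
by rewrite -poweRrM mulrC.
Qed.

Lemma aniso_sum_lty X (f : (X -> scalar_space R K)^nat) (x : X^nat) :
  aniso_sum s q f x < +oo <-> aniso_lp f x < +oo.
Proof.
rewrite -aniso_lpE; split; first exact: poweR_lty.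
by apply: lty_poweRy; rewrite invr_eq0 gt_eqF.
Qed.

Lemma ell_dual_norm_ge0 X (f : (X -> scalar_space R K)^nat) : 0 <= ell_dual_norm r f.
Proof. exact: lp_ge0. Qed.

Lemma ell_dual_norm_lty X (f : (X -> scalar_space R K)^nat) : ell_dual r f ->
  ell_dual_norm r f < +oo.
Proof. by move=> [_ ?]; exact: poweR_lty. Qed.

Lemma ell_dual_norm_fin X (f : (X -> scalar_space R K)^nat) : ell_dual r f ->
  ell_dual_norm r f \is a fin_num.
Proof. by move=> fr; rewrite ge0_fin_numE ?ell_dual_norm_lty// ell_dual_norm_ge0. Qed.

Lemma ell_dualP X (f : (X -> scalar_space R K)^nat) : (forall k, dual (f k)) ->
  ell_dual_norm r f < +oo -> ell_dual r f.
Proof.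
by move=> cf fr; split=> //; apply: (lty_poweRy _ fr); rewrite invr_eq0 gt_eqF.
Qed.

Lemma dual_lp_ge0 X (f : (X -> scalar_space R K)^nat) (z : X) : 0 <= dual_lp f z.
Proof. exact: lp_ge0. Qed.
Hint Resolve dual_lp_ge0 : core.

(** Here [r <= s] enters: the inner [s]-norm is at most the [r]-norm, which the functional bounds
    control. *)
Lemma dual_lp_le X (f : (X -> scalar_space R K)^nat) (z : X) : ell_dual r f ->
  dual_lp f z <= ell_dual_norm r f * (rnorm z)%:E.
Proof.
move=> [cf _]; rewrite muleC -lpZ//; last by move=> k; exact: (opnorm_ge0 (cf k)).
apply: (@le_trans _ _ (lp r (fun k => (rnorm (f k z))%:E))); first exact: lp_incl.
by apply: le_lp => // k; rewrite muleC; exact: (lee_opnorm (cf k)).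
Qed.

Lemma dual_lp0 X (f : (X -> scalar_space R K)^nat) : ell_dual r f ->
  dual_lp f 0%R = 0.
Proof.
move=> [cf _]; apply: lp_eq0 => // k.
by rewrite (cont_linear0 (cf k)) rnorm0.
Qed.

Lemma dual_lpD X (f : (X -> scalar_space R K)^nat) (y z : X) : ell_dual r f ->
  dual_lp f (y + z)%R <= dual_lp f y + dual_lp f z.
Proof.
move=> [cf _].
apply: (@le_trans _ _ (lp s (fun k => (rnorm (f k y))%:E + (rnorm (f k z))%:E))).
  by apply: le_lp => // k; rewrite (cont_linearD (cf k)) -EFinD lee_fin rnormD.
exact: lpD.
Qed.

Lemma aniso_lp_ub X (f : (X -> scalar_space R K)^nat) (x : X^nat) : ell_dual r f ->
  ell_dual_norm r f <= 1 -> aniso_lp f x <= ell_aniso_norm s q r x.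
Proof.
by move=> fr f1; rewrite -aniso_lpE; apply: ereal_sup_ubound; exists f.
Qed.

Lemma ell_aniso_norm_leP X (x : X^nat) c :
  (forall f : (X -> scalar_space R K)^nat, ell_dual r f -> ell_dual_norm r f <= 1 ->
     aniso_lp f x <= c) -> ell_aniso_norm s q r x <= c.
Proof.
by move=> xc; apply: ge_ereal_sup => _ [f [fr f1] <-]; rewrite aniso_lpE; exact: xc.
Qed.

Lemma ell_dual_scale X (f : (X -> scalar_space R K)^nat) (c : R) : (0 <= c)%R ->
  ell_dual r f -> let g k (z : X) : scalar_space R K := (real_scalar K c *: f k z)%R in
  [/\ ell_dual r g, ell_dual_norm r g <= c%:E * ell_dual_norm r f &
      forall x, aniso_lp g x = c%:E * aniso_lp f x].
Proof.
move=> c0 fr; have [cf _] := fr; move=> g.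
have cg k : dual (g k) := cont_linear_scale _ (cf k).
have gn : ell_dual_norm r g <= c%:E * ell_dual_norm r f.
  rewrite -lpZ//; last by move=> k; exact: (opnorm_ge0 (cf k)).
  apply: le_lp => // k; first exact: (opnorm_ge0 (cg k)).
  by apply: (le_trans (opnorm_scale _ (cf k))); rewrite rnorm_scalar ger0_norm.
split=> //.
  by apply: ell_dualP => //; rewrite (le_lt_trans gn)// lte_mul_pinfty ?ell_dual_norm_lty.
move=> x; rewrite -lpZ//; congr (lp q); apply/funext => j.
rewrite /dual_lp -lpZ//; congr (lp s); apply/funext => k.
by rewrite rnormZ rnorm_scalar ger0_norm// EFinM.
Qed.

Lemma aniso_lp_le X (f : (X -> scalar_space R K)^nat) (x : X^nat) : ell_dual r f ->
  aniso_lp f x <= ell_dual_norm r f * ell_aniso_norm s q r x.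
Proof.
move=> fr; have [f0|f0] := eqVneq (ell_dual_norm r f) 0.
  rewrite f0 mul0e /aniso_lp lp_eq0// => j; apply/eqP; rewrite eq_le dual_lp_ge0 andbT.
  by rewrite (le_trans (dual_lp_le _ fr))// f0 mul0e.
pose c := fine (ell_dual_norm r f).
have cE : ell_dual_norm r f = c%:E by rewrite fineK ?ell_dual_norm_fin.
have c0 : (0 < c)%R by rewrite -lte_fin -cE lt0e f0 ell_dual_norm_ge0.
have cV0 : (0 <= c^-1)%R by rewrite invr_ge0 ltW.
have [gr gn gE] := ell_dual_scale cV0 fr.
rewrite cE -lee_pdivrMl// -gE; apply: aniso_lp_ub => //.
by rewrite (le_trans gn)// cE -EFinM mulVf ?gt_eqF.
Qed.

Definition single_dual X (g : X -> scalar_space R K) :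
    (X -> scalar_space R K)^nat :=
  fun k => if k is 0%N then g else fun=> 0%R.

(** A single functional counts as a test sequence, so the anisotropic norm controls each scalar
    sequence [g \o x]. *)
Lemma single_dualP X (g : X -> scalar_space R K) : dual g -> opnorm g <= 1 ->
  [/\ ell_dual r (single_dual g), ell_dual_norm r (single_dual g) <= 1 &
      forall z, (rnorm (g z))%:E <= dual_lp (single_dual g) z].
Proof.
move=> cg g1; have c0 := @cont_linear_cst0 R K X (scalar_space R K).
have cf k : dual (single_dual g k) by case: k.
have fn : ell_dual_norm r (single_dual g) <= 1.
  apply: (le_trans (le_lp_series r1 _)); first by move=> k; exact: (opnorm_ge0 (cf k)).
  rewrite nneseries_recl//; last by move=> k _; exact: (opnorm_ge0 (cf k)).
  rewrite eseries0 ?adde0// => -[|k]// _ _.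
  apply/eqP; rewrite eq_le opnorm_ge0// andbT.
  by apply: opnorm_le => // u; rewrite /= rnorm0 mul0r.
split=> //; first by apply: ell_dualP => //; apply: (le_lt_trans fn); exact: ltry.
by move=> z; exact: (@le_lp_term _ s (fun k => (rnorm (single_dual g k z))%:E) 0).
Qed.

Lemma ell_aniso_norm_ge0 X (x : X^nat) : 0 <= ell_aniso_norm s q r x.
Proof.
have c0 := @cont_linear_cst0 R K X (scalar_space R K).
have [|fr f1 _] := single_dualP c0.
  by apply: opnorm_le => // u; rewrite rnorm0 mul1r rnorm_ge0.
by apply: (le_trans _ (aniso_lp_ub x fr f1)); exact: lp_ge0.
Qed.

Lemma ell_dual_comp X Y (B : X -> Y) (f : (Y -> scalar_space R K)^nat) :
  cont_linear B -> ell_dual r f ->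
  ell_dual r (fun k => f k \o B) /\
  ell_dual_norm r (fun k => f k \o B) <= opnorm B * ell_dual_norm r f.
Proof.
move=> cB fr; have [cf _] := fr.
have cfB k : dual (f k \o B) := cont_linear_comp cB (cf k).
have h : ell_dual_norm r (fun k => f k \o B) <= opnorm B * ell_dual_norm r f.
  rewrite -(fineK (opnorm_fin cB)) -lpZ ?fine_ge0 ?opnorm_ge0//; last first.
    by move=> k; exact: (opnorm_ge0 (cf k)).
  apply: le_lp => // k; first exact: (opnorm_ge0 (cfB k)).
  by rewrite fineK ?opnorm_fin// muleC; exact: (opnorm_comp cB (cf k)).
split=> //; apply: ell_dualP => //; apply: (le_lt_trans h).
rewrite -(fineK (opnorm_fin cB)).
by rewrite lte_mul_pinfty ?lee_fin ?fine_ge0 ?opnorm_ge0 ?ell_dual_norm_lty.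
Qed.

Lemma aniso_lp_concat X (f : (X -> scalar_space R K)^nat) (x : nat -> X^nat) :
  aniso_lp f (concat x) = lp q (fun i => aniso_lp f (x i)).
Proof. exact: (lp_concat (fun i j => dual_lp f (x i j)) q0). Qed.

Lemma dual_lp_trunc X (f : (X -> scalar_space R K)^nat) (x : X^nat) J j :
  ell_dual r f ->
  dual_lp f (trunc J x j) = if (j < J)%N then dual_lp f (x j) else 0.
Proof. by move=> fr; rewrite /trunc; case: ifP => // _; rewrite dual_lp0. Qed.

(** For [seq_lin] the operator is moved onto the functionals and its norm is absorbed by
    homogeneity, [aniso_lp_le]. Interleaving the [x i] acts on the outer index only, where the
    exponent is [q]. *)
Lemma ell_aniso_class : sequence_class (@ell_aniso_norm R K s q r).
Proof.
split; rewrite /=.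
- exact: ell_aniso_norm_ge0.
- move=> X Y B x cB; apply: ell_aniso_norm_leP => f fr f1.
  have [gr gn] := ell_dual_comp cB fr.
  apply: (@le_trans _ _ (aniso_lp (fun k => f k \o B) x)) => //.
  apply: (le_trans (aniso_lp_le x gr)); rewrite lee_wpmul2r ?ell_aniso_norm_ge0//.
  by rewrite (le_trans gn)// -[leRHS]mule1 lee_wpmul2l ?opnorm_ge0.
- move=> X x y; apply: ell_aniso_norm_leP => f fr f1.
  apply: (@le_trans _ _ (lp q (fun j => dual_lp f (x j) + dual_lp f (y j)))).
    by apply: le_lp => // j; exact: dual_lpD.
  by apply: (le_trans (lpD _ _ _)) => //; apply: leeD; exact: aniso_lp_ub.
- move=> X x; apply: ell_aniso_norm_leP => f fr f1.
  apply: (le_trans (le_lp_series q1 _)) => //; apply: lee_nneseries => // j _.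
  apply: (le_trans (dual_lp_le _ fr)).
  by rewrite -[leRHS]mul1e lee_wpmul2r.
- move=> X x j; have [g [cg g1 gx]] := hahn_banach (x j).
  have [fr f1 gf] := single_dualP cg g1.
  apply: (le_trans _ (aniso_lp_ub x fr f1)).
  apply: (@le_trans _ _ (rnorm (g (x j)))%:E); first by rewrite lee_fin.
  apply: (le_trans (gf (x j))).
  exact: (@le_lp_term _ q (fun j => dual_lp (single_dual g) (x j))).
- move=> X x J; apply: ell_aniso_norm_leP => f fr f1.
  apply: (le_trans _ (aniso_lp_ub x fr f1)).
  by apply: le_lp => // j; rewrite dual_lp_trunc//; case: ifP.
- move=> X x c c0 xc; apply: ell_aniso_norm_leP => f fr f1.
  apply: lp_le_trunc => // J; apply: (le_trans _ (xc J)).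
  apply: (le_trans _ (aniso_lp_ub (trunc J x) fr f1)).
  by apply: le_lp => // [j|j]; rewrite ?dual_lp_trunc//; case: ifP.
- move=> X x; apply: ell_aniso_norm_leP => f fr f1; rewrite aniso_lp_concat.
  apply: (le_trans (le_lp_series q1 _)); first by move=> i; exact: lp_ge0.
  apply: lee_nneseries => i _; first by move=> _; exact: lp_ge0.
  exact: aniso_lp_ub.
- move=> X x i; apply: ell_aniso_norm_leP => f fr f1.
  apply: (le_trans _ (aniso_lp_ub (concat x) fr f1)); rewrite aniso_lp_concat.
  by apply: (@le_lp_term _ q (fun i => aniso_lp f (x i))) => // j; exact: lp_ge0.
Qed.

Lemma ell_anisoP X (x : X^nat) : ell_aniso s q r x <-> ell_aniso_norm s q r x < +oo.
Proof.
split=> [xA|xA f fr]; last first.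
  apply/aniso_sum_lty; apply: (le_lt_trans (aniso_lp_le x fr)).
  rewrite -(fineK (ell_dual_norm_fin fr)).
  by rewrite lte_mul_pinfty ?lee_fin ?fine_ge0 ?ell_dual_norm_ge0.
rewrite ltNge leye_eq; apply/negP => /eqP xoo.
have : forall i, exists f : (X -> scalar_space R K)^nat,
    [/\ ell_dual r f, ell_dual_norm r f <= (2 ^- i)%:E & (2 ^+ i)%:E <= aniso_lp f x].
  move=> i; have p2 : (0 < 2 ^+ i :> R)%R by rewrite exprn_gt0.
  have : ((2 ^+ i * 2 ^+ i)%:E < ell_aniso_norm s q r x) by rewrite xoo ltry.
  move=> /ereal_sup_gt[_ [f [fr f1] <-]]; rewrite aniso_lpE => fx.
  have cV0 : (0 <= 2 ^- i :> R)%R by rewrite invr_ge0 ltW.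
  have [gr gn gE] := ell_dual_scale cV0 fr.
  eexists; split; first exact: gr.
    by rewrite (le_trans gn)// -[leRHS]mule1 lee_wpmul2l// lee_fin.
  by rewrite gE lee_pdivlMl// -EFinM ltW.
move=> /choice[f fP].
pose g := concat f.
have gr : ell_dual r g.
  apply: ell_dualP; first by move=> k; have [[+ _] _ _] := fP (unpair k).1; apply.
  have -> : ell_dual_norm r g = lp r (fun i => ell_dual_norm r (f i)).
    exact: (lp_concat (fun i k => opnorm (f i k)) r0).
  apply: (le_lt_trans (le_lp_series r1 _)); first by move=> i; exact: lp_ge0.
  apply: (le_lt_trans _ (half_series_lty R)); apply: lee_nneseries => i _.
    by move=> _; exact: lp_ge0.
  by have [_ ? _] := fP i.
have := xA _ gr; move=> /aniso_sum_lty.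
rewrite (@pow2_unbounded _ (aniso_lp g x))// => i.
(* Interleaving the functionals enlarges the inner index set: for each [j] the inner norm along [g]
   dominates that of its block [f i]. *)
have [_ _ /le_trans] := fP i; apply; apply: le_lp => // j.
rewrite [leRHS](_ : _ = lp s (fun i => dual_lp (f i) (x j))).
  exact: (@le_lp_term _ s (fun i => dual_lp (f i) (x j))).
exact: (lp_concat (fun i k => (rnorm (f i k (x j)))%:E) s0).
Qed.

End ell_aniso_class.

(** * Finiteness of the weak norm *)

(** [2 d x] is the difference of [y + d x] and [y - d x], so both norms cannot be below [d] times
    the norm of [x], whatever [y] is. *)
Lemma seq_norm_addsub (R : realType) (K : scalar_kind)
    (n : forall X : banach R K, X^nat -> \bar R) (nC : sequence_class n)
    (X : banach R K) (x y : X^nat) (d : R) : 0 < d ->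
  (d%:E * n X x <= n X (fun j => y j + real_scalar K d *: x j)%R \/
   d%:E * n X x <= n X (fun j => y j - real_scalar K d *: x j)%R)%E.
Proof.
move=> d0; set a := n X (fun j => y j + _); set b := n X (fun j => y j - _).
have [a_le|a_lt] := leP (d%:E * n X x)%E a; [by left|right].
have [//|b_lt] := leP (d%:E * n X x)%E b.
have e0 : 0 < (2 * d)^-1 :> R by rewrite invr_gt0 mulr_gt0.
have : (n X x <= (2 * d)^-1%:E * (a + b))%E.
  have := seqZ nC (real_scalar K (2 * d)^-1)
    (fun j => (y j + real_scalar K d *: x j) - (y j - real_scalar K d *: x j)).
  rewrite rnorm_scalar gtr0_norm// (_ : (fun j => _) = x).
    move=> /le_trans; apply; rewrite lee_wpmul2l ?lee_fin ?(ltW e0)//.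
    exact: (seq_normB nC (fun j => y j + real_scalar K d *: x j)
      (fun j => y j - real_scalar K d *: x j)).
  apply/funext => j; rewrite opprB addrC subrKA -scalerDl -real_scalarD scalerA.
  rewrite -real_scalarM (_ : _ * _ = 1) ?real_scalar1 ?scale1r//.
  by field; rewrite gt_eqF.
rewrite leNgt => /negP[]; rewrite lte_pdivrMl ?mulr_gt0//.
have -> : ((2 * d)%:E * n X x = d%:E * n X x + d%:E * n X x)%E.
  rewrite -ge0_muleDl ?lee_fin ?(ltW d0)// -EFinD; congr (_%:E * _)%E; ring.
exact: lteD.
Qed.

Section gliding_hump.
Variables (R : realType) (K : scalar_kind) (p : R).
Hypothesis p1 : 1 <= p.
Variables (X : banach R K) (u : X^nat).
Let C := @ell_class R K p p1.
Local Notation dual := (@dual R K X).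

(* The functional [f] is a limit of sums of [+- 3 ^- k *: h k]; by seq_norm_addsub the
   sign can be chosen so that step [n] contributes at least [3/4 * 3 ^- n * W n], while all later
   steps together change the value by at most [1/2 * 3 ^- n * W n]. *)
Lemma gliding_hump (J : nat -> nat) (W : nat -> R) (h : nat -> X -> scalar_space R K) :
  (forall n, ell_weak_norm p (trunc (J n) u) = (W n)%:E) ->
  (forall n, dual (h n) /\ (opnorm (h n) <= 1)%E) ->
  (forall n, ((3 / 4 * W n)%:E <= ell_norm p (h n \o trunc (J n) u))%E) ->
  exists2 f, dual f & forall n, ((3 ^- n * (W n / 4))%:E <= ell_norm p (f \o u))%E.
Proof.
move=> WE hP hW.
have W0 n : 0 <= W n by rewrite -lee_fin -WE ell_weak_norm_ge0.
have d0 n : 0 < 3 ^- n :> R by rewrite invr_gt0 exprn_gt0.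
(* The choice ranges over all functions, so continuity of the previous functional is a premise
   within the property; induction supplies it afterwards. *)
have /choice[F FP] : forall ng : nat * (X -> scalar_space R K), exists g',
    dual ng.2 -> [/\ dual g',
      forall x, rnorm (g' x - ng.2 x) <= 3 ^- ng.1 * rnorm x &
      ((3 ^- ng.1)%:E * ell_norm p (h ng.1 \o trunc (J ng.1) u) <=
        ell_norm p (g' \o trunc (J ng.1) u))%E].
  move=> [n g] /=; have [ch h1] := hP n.
  have hx x : rnorm (real_scalar K (3 ^- n) *: h n x) <= 3 ^- n * rnorm x.
    rewrite rnormZ rnorm_scalar gtr0_norm// ler_wpM2l ?(ltW (d0 n))// -lee_fin.
    rewrite (le_trans (lee_opnorm ch x))// -[leRHS]mul1e lee_wpmul2r// lee_fin.
    exact: rnorm_ge0.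
  have ch' := cont_linear_scale (real_scalar K (3 ^- n)) ch.
  have [le|le] := seq_norm_addsub C (h n \o trunc (J n) u) (g \o trunc (J n) u) (d0 n).
    exists (fun x => g x + real_scalar K (3 ^- n) *: h n x) => cg.
    by split=> // [|x]; [exact: cont_linear_add|rewrite addrC addKr].
  exists (fun x => g x - real_scalar K (3 ^- n) *: h n x) => cg.
  by split=> // [|x]; [exact: cont_linear_sub|rewrite addrAC subrr sub0r rnormN].
pose f n : X -> scalar_space R K := iteri n (fun i g => F (i, g)) (fun=> 0).
have cf n : dual (f n).
  elim: n => [|n IH]; first exact: cont_linear_cst0.
  by have [] := FP (n, f n) IH.
have fP n := FP (n, f n) (cf n).
(* The factor is the geometric sum of [3 ^- i] for [i] from [n] up to [n + m - 1]. *)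
have f_cauchy n m x :
    rnorm (f (n + m)%N x - f n x) <= 3 / 2 * (3 ^- n - 3 ^- (n + m)) * rnorm x.
  elim: m => [|m IH]; first by rewrite addn0 !subrr rnorm0 mulr0 mul0r.
  have [_ /(_ x) /= step _] := fP (n + m)%N.
  rewrite addnS -(subrKA (f (n + m)%N x)) (le_trans (rnormD _ _))//.
  apply: (le_trans (lerD step IH)); rewrite -mulrDl ler_wpM2r ?rnorm_ge0//.
  rewrite exprS invfM; lra.
have f_cauchy' n m x : (n <= m)%N -> rnorm (f m x - f n x) <= 3 / 2 * 3 ^- n * rnorm x.
  move=> nm; have := f_cauchy n (m - n)%N x; rewrite subnKC// => /le_trans; apply.
  by rewrite ler_wpM2r ?rnorm_ge0// ler_wpM2l// lerBlDr lerDl ltW.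
have [|g cg fg] := cont_linear_lim cf.
  (* Two deviations from [f N], each at most [3 / 2 * 3 ^- N]. *)
  move=> e e0; have [N Ne] : exists N, 3 * 3 ^- N <= e :> R.
    exists (Num.bound (3 / e)); rewrite ler_pdivrMr ?exprn_gt0// mulrC -ler_pdivrMr//.
    have q0 : 0 <= 3 / e by rewrite divr_ge0// ltW.
    rewrite (le_trans (ltW (archi_boundP q0)))// -natrX ler_nat ltnW//.
    exact: ltn_expl.
  exists N => m n Nm Nn x; rewrite -(subrKA (f N x)) (le_trans (rnormD _ _))//.
  rewrite [X in _ + X]rnormB.
  apply: (le_trans (lerD (f_cauchy' N m x Nm) (f_cauchy' N n x Nn))).
  by rewrite -mulrDl ler_wpM2r ?rnorm_ge0//; lra.
exists g => // n.
have [_ _ hump] := fP n.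
pose v := trunc (J n) u.
(* The remaining steps start at [n.+1], and [3 / 2 * 3 ^- n.+1] equals [3 ^- n / 2]. *)
have gf : (opnorm (fun x => f n.+1 x - g x)%R <= (3 ^- n / 2)%:E)%E.
  apply: opnorm_le => [|x]; first by rewrite divr_ge0// ltW.
  rewrite rnormB; apply: (rnorm_le_lim (n0 := n.+1) (fg x)) => m nm.
  by rewrite (le_trans (f_cauchy' _ _ _ nm))// exprS invfM ler_wpM2r ?rnorm_ge0//; lra.
have fgv : (ell_norm p (f n.+1 \o v) <= ell_norm p (g \o v) + (3 ^- n / 2 * W n)%:E)%E.
  have := seq_add C (g \o v) ((fun x => (f n.+1 x : scalar_space R K) - g x) \o v).
  rewrite (_ : (fun j => _) = f n.+1 \o v); last first.
    by apply/funext => j /=; rewrite addrC subrK.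
  move=> /le_trans; apply; rewrite leeD2l//.
  apply: (le_trans (ell_norm_dual_le p1 v (cont_linear_sub (cf n.+1) cg))).
  by rewrite EFinM -WE lee_wpmul2r// (ell_weak_norm_ge0 p1).
have gu : (ell_norm p (g \o v) <= ell_norm p (g \o u))%E.
  by rewrite trunc_comp ?(cont_linear0 cg)//; exact: (seq_trunc C).
apply: (le_trans _ gu).
have : ((3 ^- n * (3 / 4 * W n))%:E <= ell_norm p (g \o v) + (3 ^- n / 2 * W n)%:E)%E.
  apply: (le_trans _ fgv); apply: (le_trans _ hump).
  by rewrite EFinM lee_wpmul2l ?lee_fin ?(ltW (d0 n))//; exact: hW.
rewrite -leeBlDr// -EFinB; apply: le_trans; rewrite lee_fin; lra.
Qed.

End gliding_hump.

Lemma ell_weakP (R : realType) (K : scalar_kind) (p : R) (X : banach R K)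
    (x : X^nat) : 1 <= p ->
  ell_weak p x <-> (ell_weak_norm p x < +oo)%E.
Proof.
move=> p1; have p0 := lt_le_trans ltr01 p1; have WC := @ell_weak_class R K p p1.
split=> [xw|xw g cg]; last first.
  apply/ellP => //; apply: (le_lt_trans (ell_norm_dual_le p1 x cg)).
  by rewrite -(fineK (opnorm_fin cg)) lte_mul_pinfty ?lee_fin ?fine_ge0 ?opnorm_ge0.
rewrite ltNge leye_eq; apply/negP => /eqP xoo.
(* [gliding_hump] will return [3 ^- n * (W / 4)], which is at least [2 ^+ n] once
   [W >= 4 * 6 ^+ n]. *)
have : forall n, exists JWh : nat * R * (X -> scalar_space R K),
    [/\ ell_weak_norm p (trunc JWh.1.1 x) = JWh.1.2%:E, 4 * 6 ^+ n <= JWh.1.2,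
      dual JWh.2, (opnorm JWh.2 <= 1)%E &
      ((3 / 4 * JWh.1.2)%:E <= ell_norm p (JWh.2 \o trunc JWh.1.1 x))%E].
  (* Truncation keeps the weak norm finite, so that the tail of the functionals can be controlled,
     while [seq_trunc_lim] makes it as large as required. *)
  move=> n; have [J xJ] : exists J, ((4 * 6 ^+ n)%:E < ell_weak_norm p (trunc J x))%E.
    apply: contrapT => /forallNP nJ.
    have : (ell_weak_norm p x <= (4 * 6 ^+ n)%:E)%E.
      apply: (seq_trunc_lim WC) => [|J]; first by rewrite lee_fin mulr_ge0// exprn_ge0.
      by rewrite leNgt; apply/negP; exact: nJ.
    by rewrite xoo leye_eq.
  have [W WE] : exists W : R, ell_weak_norm p (trunc J x) = W%:E.
    exists (fine (ell_weak_norm p (trunc J x))).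
    rewrite fineK// ge0_fin_numE ?(seq_ge0 WC)//.
    by rewrite (le_lt_trans (seq_trunc_le_sum WC x J))// sumEFin ltry.
  move: xJ; rewrite WE lte_fin => xJ.
  have : ((3 / 4 * W)%:E < ell_weak_norm p (trunc J x))%E.
    have : 0 < 4 * 6 ^+ n :> R by rewrite mulr_gt0// exprn_gt0.
    by rewrite WE lte_fin; lra.
  move=> /ereal_sup_gt[_ [h [ch h1] <-]] hJ.
  by exists (J, W, h); split=> //=; exact: ltW.
move=> /choice[JWh P].
have [|||f cf fx] := @gliding_hump R K p p1 X x
  (fun n => (JWh n).1.1) (fun n => (JWh n).1.2) (fun n => (JWh n).2).
- by move=> n; have [] := P n.
- by move=> n; have [] := P n.
- by move=> n; have [] := P n.
have := xw f cf; rewrite ellP// (@pow2_unbounded _ (ell_norm p (f \o x)))// => n.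
apply: le_trans (fx n); rewrite lee_fin; have [_ W6 _ _ _] := P n.
have p3 : 0 < 3 ^+ n :> R by rewrite exprn_gt0.
rewrite ler_pdivlMl// -exprMn (_ : 3 * 2 = 6 :> R); last by ring.
by move: W6; lra.
Qed.

(** * The two ideals *)

(** Over the scalars the inner norm of a test sequence of norm at most 1 is bounded by
    [rnorm (x j)], leaving a [q]-norm; [p <= q] compares it with the [p]-norm, which is the weak
    test by the identity functional. *)
Lemma ell_aniso_norm_le_weak (R : realType) (K : scalar_kind) (s q r p : R)
    (x : (scalar_space R K)^nat) :
  1 <= s -> 1 <= q -> 1 <= r -> r <= s -> 1 <= p -> p <= q ->
  (ell_aniso_norm s q r x <= ell_weak_norm p x)%E.
Proof.
move=> s1 q1 r1 rs p1 pq.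
have [s0 [q0 p0]] : 0 < s /\ 0 < q /\ 0 < p by split; [|split]; exact: lt_le_trans ltr01 _.
have x0 j : (0 <= (rnorm (x j))%:E)%E by rewrite lee_fin rnorm_ge0.
apply: ell_aniso_norm_leP => f fr f1.
have id1 : (opnorm (@id (scalar_space R K)) <= 1)%E by rewrite opnorm_id.
apply: (le_trans _ (ell_weak_norm_ub p x (@cont_linear_id R K _) id1)).
apply: (@le_trans _ _ (lp q (fun j => (rnorm (x j))%:E))).
  apply: le_lp => // j; first exact: lp_ge0.
  apply: (le_trans (dual_lp_le r1 rs _ fr)).
  by rewrite -[leRHS]mul1e lee_wpmul2r.
exact: lp_incl.
Qed.

(** The test sequence [id, 0, 0, ...] shows that the anisotropic norm dominates the [q]-norm, hence
    the [p]-norm since [q <= p]. *)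
Lemma ell_norm_le_aniso (R : realType) (K : scalar_kind) (s q r p : R)
    (x : (scalar_space R K)^nat) :
  1 <= s -> 1 <= q -> 1 <= r -> r <= s -> 1 <= p -> q <= p ->
  (ell_norm p x <= ell_aniso_norm s q r x)%E.
Proof.
move=> s1 q1 r1 rs p1 qp; have q0 : 0 < q by exact: lt_le_trans ltr01 _.
have x0 j : (0 <= (rnorm (x j))%:E)%E by rewrite lee_fin rnorm_ge0.
have id1 : (opnorm (@id (scalar_space R K)) <= 1)%E by rewrite opnorm_id.
have [fr f1 fx] := single_dualP s1 r1 (@cont_linear_id R K _) id1.
apply: (le_trans _ (aniso_lp_ub s q x fr f1)).
apply: (@le_trans _ _ (lp q (fun j => (rnorm (x j))%:E))); first exact: lp_incl.
by apply: le_lp => // j; exact: fx.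
Qed.

Theorem proposition3p17 (R : realType) (K : scalar_kind) (s q r p : R)
  (hs : 1 <= s) (hq : 1 <= q) (hr : 1 <= r) (hp : 1 <= p)
  (hqs : q < s) (hrs : r <= s) :
  (p <= q -> banach_ideal (@weakly_aniso_summing R K s q r p)
                          (@weakly_aniso_norm R K s q r p)) /\
  (q <= p -> banach_ideal (@aniso_summing R K p s q r)
                          (@aniso_norm R K p s q r)).
Proof.
have p0 : 0 < p := lt_le_trans ltr01 hp.
(* Once membership is finiteness of the norm, both pairs become literal instances of [seq_summing]
   and [seq_summing_norm]. *)
have weakE X : @ell_weak R K p X = [set x | (ell_weak_norm p x < +oo)%E].
  by apply/funext => x; apply/propext; exact: ell_weakP.
have anisoE X : @ell_aniso R K s q r X = [set x | (ell_aniso_norm s q r x < +oo)%E].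
  by apply/funext => x; apply/propext; exact: ell_anisoP.
have ellE X : @ell R K p X = [set x | (ell_norm p x < +oo)%E].
  by apply/funext => x; apply/propext; exact: ellP.
have aC := ell_aniso_class K hs hq hr hrs.
split=> pq.
  have -> : @weakly_aniso_summing R K s q r p =
      seq_summing (@ell_weak_norm R K p) (@ell_aniso_norm R K s q r).
    by apply: functional_extensionality_dep => U;
      apply: functional_extensionality_dep => X; rewrite /weakly_aniso_summing weakE anisoE.
  have -> : @weakly_aniso_norm R K s q r p =
      seq_summing_norm (@ell_weak_norm R K p) (@ell_aniso_norm R K s q r).
    apply: functional_extensionality_dep => U;
      apply: functional_extensionality_dep => X; apply/funext => T.
    by rewrite /weakly_aniso_norm weakE.
  apply: seq_summing_banach_ideal => [|//|x]; first exact: ell_weak_class.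
  exact: ell_aniso_norm_le_weak.
have -> : @aniso_summing R K p s q r =
    seq_summing (@ell_aniso_norm R K s q r) (@ell_norm R K p).
  by apply: functional_extensionality_dep => U;
      apply: functional_extensionality_dep => X; rewrite /aniso_summing ellE anisoE.
have -> : @aniso_norm R K p s q r =
    seq_summing_norm (@ell_aniso_norm R K s q r) (@ell_norm R K p).
  apply: functional_extensionality_dep => U;
      apply: functional_extensionality_dep => X; apply/funext => T.
  by rewrite /aniso_norm anisoE.
apply: seq_summing_banach_ideal => [//||x]; first exact: ell_class.
exact: ell_norm_le_aniso.
Qed.
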